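(* For every simplicial complex $\Delta\in\mathfrak{C}$, the indicators $i_{1},i_{2},i_{5},i_{12},i_{13},i_{14},i_{15},i_{24},i_{25},i_{123},i_{124},i_{125},i_{135},i_{145},i_{245},i_{1234},i_{1235},i_{1245},i_{P},i_{\bar P}$ of $\Delta$ are given by one of the six columns $\mathbf{A},\mathbf{A}^\ast,\mathbf{B},\mathbf{B}^\ast,\mathbf{C},\mathbf{C}^\ast$ of the following table: \[ \begin{array}{c|cccccc} & \mathbf{A} & \mathbf{A}^\ast & \mathbf{B} & \mathbf{B}^\ast & \mathbf{C} & \mathbf{C}^\ast\\ \hline i_{1} & 1 & 1 & 1 & 1 & 1 & 1 \\ i_{2} & 0 & 1 & 1 & 1 & 1 & 1 \\ i_{5} & 1 & 1 & 1 & 1 & 1 & 1 \\ i_{12} & 0 & 1 & 1 & 1 & 0 & 1 \\ i_{13} & 1 & 1 & 0 & 0 & 0 & 0 \\ i_{14} & 0 & 1 & 0 & 1 & 0 & 1 \\ i_{15} & 1 & 1 & 0 & 1 & 1 & 1 \\ i_{24} & 0 & 0 & 1 & 1 & 1 & 1 \\ i_{25} & 0 & 1 & 1 & 1 & 1 & 1 \\ i_{123} & 0 & 1 & 0 & 0 & 0 & 0 \\ i_{124} & 0 & 0 & 0 & 1 & 0 & 0 \\ i_{125} & 0 & 1 & 0 & 0 & 0 & 1 \\ i_{135} & 1 & 1 & 0 & 0 & 0 & 0 \\ i_{145} & 0 & 1 & 0 & 1 & 0 & 1 \\ i_{245} & 0 & 0 & 1 & 1 & 1 & 1 \\ i_{1234}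 & 0 & 0 & 0 & 0 & 0 & 0 \\ i_{1235} & 0 & 1 & 0 & 0 & 0 & 0 \\ i_{1245} & 0 & 0 & 0 & 0 & 0 & 0 \\ i_{P} & 0 & 1 & 1 & 1 & 1 & 1 \\ i_{\bar{P}} & 0 & 1 & 0 & 0 & 0 & 0 \end{array} \]
   Context: A graph property on 10 vertices is a class of (simple, undirected) graphs on the vertex set $\{1,\dots,10\}$ that is closed under isomorphism. It is monotone if it is preserved under removal of edges. It is trivial if it contains all graphs or no graphs, and nontrivial otherwise. To a monotone graph property on 10 vertices is associated the simplicial complex $\Delta$ whose vertices are graph edges (2-element subsets of $\{1,\dots,10\}$) and whose simplices are the edge sets of the graphs having the property; we write $G\in\Delta$ if the edge set of $G$ is a simplex of $\Delta$. A simplicial complex $\Delta$ is nonevasive if it is a point, or if there is a vertex $v$ of $\Delta$ such that both the link $\mathrm{lk}_\Delta(v)=\{\sigma\in\Delta\mid v\notin\sigma,\ \sigma\cup\{v\}\in\Delta\}$ and the deletion $\mathrm{dl}_\Delta(v)=\{\sigma\in\Delta\mid v\notin\sigma\}$ are nonevasive. $\mathfrak{C}$ denotes the set of nonevasive simplicial complexes associated to nontrivial monotone graph properties on 10 vertices. For $D\subseteq\{1,2,3,4,5\}$, $G_D$ is the graph on $\{1,\dots,10\}$ in which two vertices $i>j$ are adjacent if $i-j\in D$ or $10+j-i\in D$. $P$ denotes the Petersen graph and $\bar P$ its complement, with vertex set $\{1,\dots,10\}$. For a graph $G$ on 10 vertices, the indicator $i_G$ of $\Delta$ is $1$ if $G\in\Delta$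 and $0$ if $G\notin\Delta$. For the graphs $G_D$ the indicator is written by listing the elements of $D$, e.g. $i_{124}=i_{G_{\{1,2,4\}}}$. *)

(* Defs.v *)
From mathcomp Require Import all_boot all_fingroup.

Set Implicit Arguments.
Unset Strict Implicit.
Unset Printing Implicit Defensive.

(* The vertex set {1,...,10} is represented by 'I_10 via
   i |-> i - 1; only differences of vertices matter below. *)
Definition vertex := 'I_10.

Definition edge := {e : {set vertex} | #|e| == 2}.

(* A simple graph on the fixed vertex set is identified with its edge set. *)
Definition graph := {set edge}.

Definition adj (G : graph) (x y : vertex) : bool :=
  [exists e in G, val e == [set x; y]].

Definition isomorphic (G H : graph) : Prop :=
  exists s : {perm vertex}, forall x y, adj H (s x) (s y) = adj G x y.

Definition graph_property (P : {set graph}) : Prop :=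
  forall G H : graph, isomorphic G H -> G \in P -> H \in P.

Definition monotone (P : {set graph}) : Prop :=
  forall G H : graph, H \subset G -> G \in P -> H \in P.

Definition trivial_property (P : {set graph}) : Prop :=
  P = [set: graph] \/ P = set0.

(* A simplicial complex is given by the set of its simplices, the empty simplex
   included; v is a vertex of Delta when [set v] \in Delta.  In particular a
   point is the complex {emptyset, {v}}. *)
Definition link (T : finType) (Delta : {set {set T}}) (v : T) : {set {set T}} :=
  [set sigma in Delta | (v \notin sigma) && (v |: sigma \in Delta)].

Definition deletion (T : finType) (Delta : {set {set T}}) (v : T) :
    {set {set T}} :=
  [set sigma in Delta | v \notin sigma].

Inductive nonevasive (T : finType) : {set {set T}} -> Prop :=
| nonevasive_point (v : T) : nonevasive [set set0; [set v]]
| nonevasive_step (Delta : {set {set T}}) (v : T) :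
    [set v] \in Delta ->
    nonevasive (link Delta v) -> nonevasive (deletion Delta v) ->
    nonevasive Delta.

(* Since graphs are edge sets, the complex associated to a monotone property is
   the property itself, viewed as a set of subsets of [edge]. *)
Definition complex_of (P : {set graph}) : {set {set edge}} := P.

Definition frakC (Delta : {set {set edge}}) : Prop :=
  exists P : {set graph},
    [/\ graph_property P, monotone P, ~ trivial_property P,
        Delta = complex_of P & nonevasive Delta].

(* The circulant graph G_D; D lists elements of {1,...,5}. *)
Definition circ (D : seq nat) : graph :=
  [set e : edge | [exists i : vertex, exists j : vertex,
     [&& j < i, val e == [set i; j] & (i - j \in D) || (10 + j - i \in D)]]].

(* The Petersen graph as outer 5-cycle 0,...,4, spokes i -- i + 5, and inner
   pentagram on 5,...,9. *)
Definition petersen : graph :=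
  [set e : edge | [exists i : 'I_5,
     [|| val e == [set inord i; inord (i.+1 %% 5)],
         val e == [set inord i; inord (5 + i)]
       | val e == [set inord (5 + i); inord (5 + i.+2 %% 5)]]]].

Definition indicator (Delta : {set {set edge}}) (G : graph) : nat :=
  G \in Delta.

(* Columns, numbered from 0: A, A*, B, B*, C, C*. *)
Definition table : seq (graph * seq nat) :=
  [:: (circ [:: 1],          [:: 1; 1; 1; 1; 1; 1]);
      (circ [:: 2],          [:: 0; 1; 1; 1; 1; 1]);
      (circ [:: 5],          [:: 1; 1; 1; 1; 1; 1]);
      (circ [:: 1; 2],       [:: 0; 1; 1; 1; 0; 1]);
      (circ [:: 1; 3],       [:: 1; 1; 0; 0; 0; 0]);
      (circ [:: 1; 4],       [:: 0; 1; 0; 1; 0; 1]);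
      (circ [:: 1; 5],       [:: 1; 1; 0; 1; 1; 1]);
      (circ [:: 2; 4],       [:: 0; 0; 1; 1; 1; 1]);
      (circ [:: 2; 5],       [:: 0; 1; 1; 1; 1; 1]);
      (circ [:: 1; 2; 3],    [:: 0; 1; 0; 0; 0; 0]);
      (circ [:: 1; 2; 4],    [:: 0; 0; 0; 1; 0; 0]);
      (circ [:: 1; 2; 5],    [:: 0; 1; 0; 0; 0; 1]);
      (circ [:: 1; 3; 5],    [:: 1; 1; 0; 0; 0; 0]);
      (circ [:: 1; 4; 5],    [:: 0; 1; 0; 1; 0; 1]);
      (circ [:: 2; 4; 5],    [:: 0; 0; 1; 1; 1; 1]);
      (circ [:: 1; 2; 3; 4], [:: 0; 0; 0; 0; 0; 0]);
      (circ [:: 1; 2; 3; 5], [:: 0; 1; 0; 0; 0; 0]);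
      (circ [:: 1; 2; 4; 5], [:: 0; 0; 0; 0; 0; 0]);
      (petersen,             [:: 0; 1; 1; 1; 1; 1]);
      (~: petersen,          [:: 0; 1; 0; 0; 0; 0])].

(* Main.v *)
Require Import Defs.
From mathcomp Require Import all_boot all_fingroup all_algebra.
From mathcomp Require Import zify.

(** A nonevasive complex is contractible; a contractible complex with many
    symmetries is severely constrained by fixed point theorems, and a graph
    property is invariant under all permutations of the vertices.

    The constraints come from the following principle ([block_euler_eq0]).  Let
    commuting permutations of order [p] act on the complex [D].  By Smith theory the
    poset of nonempty invariant faces is acyclic modulo [p], hence rationally, so
    by the Lefschetz formula every monotone self-map of this poset has a set of
    fixed points of Euler characteristic 1.  When the fixed points are the faces
    that are unions of some disjoint blocks of edges, this says that the
    alternating sum of the indicators of all unions of blocks vanishes, the empty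
    union included.  Everything is done on order complexes, where a group acts
    without signs and a chain that is stabilized is fixed pointwise.  The steps are
    [nonevasive_acyclic], proved by adding faces one at a time along
    acyclic links; [smith], by the classical exact sequences between the kernels of
    the norm and of the difference operator; [lefschetz], by a trace argument on a
    contraction, [hopf_trace], which also passes from characteristic [p] to the
    integers; and [chain_sum_faces], which compares chains of faces with
    faces.

    Four applications to ten vertices on a circle are enough.  In three of them
    the self-map is the rotation by one, and the group is trivial
    ([euler_cyclic]), generated by the rotations of the even and of the odd
    vertices ([euler_cliques]), or generated by the swaps of antipodal vertices
    ([euler_matching]).  In the last one ([euler_pentagons]) the group is generated
    by the rotation by two, and the self-map is a retraction: if an invariant
    graph has an edge between the even and the odd vertices, it has a whole perfect
    matching between them, and rotating the odd vertices turns this matching into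
    the antipodal one without moving the rest.  So all edges between the two
    halves can be replaced by the antipodal matching.  The unions of blocks are
    then disjoint unions of pentagons and five-cliques, prisms, the Petersen graph,
    and so on.

    Up to isomorphism these equations involve the twenty graphs of the table and
    six others.  Together with monotonicity for 21 embeddings between these
    graphs, they leave only the six columns ([case_analysis]). *)

Set Implicit Arguments.
Unset Strict Implicit.
Unset Printing Implicit Defensive.

Import GRing.Theory Num.Theory.

(** * Traces over an exact complex *)

Section Trace.
Local Open Scope ring_scope.

(** With [h] a generalized inverse of [D], the defect [1 - D h] maps into the
    kernel of [D], hence into its image, where [h D] is the identity; this
    makes [h - D h h] a contraction. *)
Lemma exact_contraction (F : fieldType) n (D : 'M[F]_n) :
  D *m D = 0 -> (kermx D <= D)%MS -> exists H, D *m H + H *m D = 1%:M.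
Proof.
move=> DD kerD.
have [h DhD] : exists h, D *m h *m D = D by exists (pinvmx D); apply: mulmxKpV.
exists (h - D *m h *m h).
have ker1 : ((1%:M - D *m h) <= kermx D)%MS.
  by apply/sub_kermxP; rewrite mulmxBl mul1mx DhD subrr.
have: ((1%:M - D *m h) <= D)%MS := submx_trans ker1 kerD.
move/submxP => [y yE].
have fixD : (1%:M - D *m h) *m h *m D = 1%:M - D *m h.
  by rewrite yE -!mulmxA (mulmxA D h D) DhD.
rewrite mulmxBr -!mulmxA (mulmxA D D) DD mul0mx subr0.
rewrite mulmxBl mul1mx in fixD.
by rewrite mulmxA fixD addrC subrK.
Qed.

(** [U = D H + H D] commutes with [D], so it splits the super-trace of [G] into
    two terms exchanged, up to the sign of [S D = - D S], by cyclicity of the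
    trace. *)
Lemma trace_of_contraction (F : fieldType) n (S D G H : 'M[F]_n) :
  S *m D = - (D *m S) -> D *m D = 0 -> D *m G = G *m D ->
  D *m H + H *m D \in unitmx -> \tr (S *m G) = 0.
Proof.
move=> SD DD DG; move UE: (D *m H + H *m D) => U unitU.
have DU : D *m U = U *m D.
  by rewrite -UE mulmxDr mulmxDl !mulmxA DD mul0mx add0r -(mulmxA H D D) DD
    mulmx0 addr0.
have DV : D *m invmx U = invmx U *m D.
  rewrite -[LHS]mul1mx -(mulVmx unitU) -!mulmxA; congr (_ *m _).
  by rewrite !mulmxA -DU -mulmxA mulmxV // mulmx1.
have -> : S *m G = S *m G *m D *m H *m invmx U + S *m G *m H *m invmx U *m D.
  rewrite -(mulmxA _ (invmx U) D) -DV !mulmxA -mulmxDl.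
  have -> : S *m G *m D *m H + S *m G *m H *m D = S *m G *m U.
    by rewrite -UE mulmxDr !mulmxA.
  by rewrite mulmxK.
rewrite mxtraceD (mxtrace_mulC _ D) !mulmxA.
have -> : D *m S = - (S *m D) by rewrite SD opprK.
by rewrite !mulNmx linearN /= -(mulmxA S D G) DG !mulmxA subrr.
Qed.

(** Exactness modulo [p] gives a vanishing super-trace in the integers, not just
    modulo [p]: lift a contraction modulo [p] to an integer matrix [H]; then
    [D H + H D] is the identity modulo [p], so its determinant is nonzero and it
    is invertible over the rationals. *)
Lemma hopf_trace (I : finType) (A : {set I}) (par : I -> bool)
    (D G : I -> I -> int) (p : nat) : prime p ->
  {in A &, forall i j, par i = par j -> D i j = 0} ->
  {in A &, forall i k, \sum_(j in A) D i j * D j k = 0} ->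
  {in A &, forall i k,
     \sum_(j in A) D i j * G j k = \sum_(j in A) G i j * D j k} ->
  (forall v : I -> 'F_p,
     {in A, forall k, \sum_(i in A) v i * (D i k)%:~R = 0} ->
     exists w : I -> 'F_p,
       {in A, forall k, v k = \sum_(i in A) w i * (D i k)%:~R}) ->
  \sum_(i in A) (-1) ^+ par i * G i i = 0.
Proof.
move=> p_pr odd_D DD DG exD; pose n := #|A|.
pose mx (M : I -> I -> int) : 'M[int]_n :=
  \matrix_(i, j) M (enum_val i) (enum_val j).
pose Dm := mx D; pose Gm := mx G.
pose Sm : 'M[int]_n := diag_mx (\row_i (-1) ^+ par (enum_val i)).
have inA (i : 'I_n) : enum_val i \in A by apply: enum_valP.
have mulE (M N : I -> I -> int) i k : (mx M *m mx N) i k =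
    \sum_(j in A) M (enum_val i) j * N j (enum_val k).
  rewrite mxE [RHS]big_enum_val /=.
  by apply: eq_bigr => j _; rewrite !mxE.
have DDm : Dm *m Dm = 0 by apply/matrixP => i k; rewrite mulE mxE DD.
have DGm : Dm *m Gm = Gm *m Dm by apply/matrixP => i k; rewrite !mulE DG.
have SDm : Sm *m Dm = - (Dm *m Sm).
  apply/matrixP => i j; rewrite mul_diag_mx mul_mx_diag !mxE.
  case: (boolP (par (enum_val i) == par (enum_val j))) => [/eqP e|ne].
    by rewrite odd_D // mulr0 mul0r oppr0.
  move: ne; case: (par _); case: (par _) => //= _;
    by rewrite ?expr1 ?expr0 ?mulN1r ?mulrN1 ?mul1r ?mulr1 ?opprK.
pose red m q (M : 'M[int]_(m, q)) : 'M['F_p]_(m, q) := map_mx intr M.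
have redM m q r (M : 'M_(m, q)) (N : 'M_(q, r)) :
  red _ _ (M *m N) = red _ _ M *m red _ _ N by rewrite /red map_mxM.
have [Hp HpE] : exists H, red _ _ Dm *m H + H *m red _ _ Dm = 1%:M.
  apply: exact_contraction; first by rewrite -redM DDm /red map_mx0.
  apply/row_subP => i.
  set v := row i _.
  have v0 : v *m red _ _ Dm = 0 by rewrite -row_mul mulmx_ker row0.
  (* [f] is the vector [v] read along the enumeration of [A] *)
  pose f (x : I) : 'F_p := if [pick k : 'I_n | enum_val k == x] is Some k
                           then v 0 k else 0.
  have fE k : f (enum_val k) = v 0 k.
    rewrite /f; case: pickP => [k' /eqP/enum_val_inj -> //|/(_ k)].
    by rewrite eqxx.
  have [x xA|w wE] := exD f.
    have := congr1 (fun M : 'rV_n => M 0 (enum_rank_in xA x)) v0.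
    rewrite /= !mxE => e; apply: etrans e; rewrite [LHS]big_enum_val /=.
    by apply: eq_bigr => j _; rewrite fE !mxE enum_rankK_in.
  apply/submxP; exists (\row_k w (enum_val k)); apply/rowP => k.
  rewrite -fE wE // mxE [LHS]big_enum_val /=.
  by apply: eq_bigr => j _; rewrite !mxE.
pose H : 'M[int]_n := \matrix_(i, j) (Hp i j : nat)%:Z.
have redH : red _ _ H = Hp.
  by apply/matrixP => i j; rewrite !mxE /= -pmulrn natr_Zp.
pose U := Dm *m H + H *m Dm.
have detU : \det U != 0.
  have : red _ _ U = 1%:M by rewrite /U /red map_mxD -!/(red _ _ _) !redM redH.
  move/(congr1 determinant); rewrite det_map_mx det1 => dU.
  by apply/eqP => U0; move: dU; rewrite U0 => /esym/eqP; rewrite oner_eq0.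
pose emb m q (M : 'M[int]_(m, q)) : 'M[rat]_(m, q) := map_mx intr M.
have embM m q r (M : 'M_(m, q)) (N : 'M_(q, r)) :
  emb _ _ (M *m N) = emb _ _ M *m emb _ _ N by rewrite /emb map_mxM.
have : \tr (emb _ _ Sm *m emb _ _ Gm) = 0.
  apply: (@trace_of_contraction _ _ _ (emb _ _ Dm) _ (emb _ _ H)).
  - by rewrite -!embM SDm /emb map_mxN.
  - by rewrite -embM DDm /emb map_mx0.
  - by rewrite -!embM DGm.
  rewrite -!embM -/(emb _ _ _) /emb -map_mxD unitmxE det_map_mx unitfE.
  by rewrite intr_eq0.
rewrite -embM /emb trace_map_mx => /eqP; rewrite intr_eq0 => /eqP e.
apply: etrans e; rewrite [LHS]big_enum_val /=.
by apply: eq_bigr => i _; rewrite mul_diag_mx !mxE.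
Qed.
End Trace.

(** * Chains of a finite poset *)

Definition supported (X : finType) (F : nmodType) (K : {set X}) (v : X -> F) :=
  forall c, c \notin K -> v c = 0%R.

Section OrderComplex.
Variables (V : finType) (lt : rel V).
Hypotheses (lt_irr : irreflexive lt) (lt_trans : transitive lt).
Implicit Types (c d Q : {set V}) (x y : V).

Definition chain c :=
  [forall x in c, forall y in c, [|| x == y, lt x y | lt y x]].

Definition chains Q : {set {set V}} := [set c | chain c && (c \subset Q)].

(** The rank of [x] in the chain [c]. *)
Definition below c x := #|[set y in c | lt y x]|.

Lemma chainP c :
  reflect {in c &, forall x y, [|| x == y, lt x y | lt y x]} (chain c).
Proof.
apply: (iffP forall_inP) => [h x y xc yc|h x xc].
  by move/forall_inP: (h x xc); apply.
by apply/forall_inP => y yc; apply: h.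
Qed.

Lemma lt_asym x y : lt x y -> lt y x = false.
Proof. by move=> xy; apply/negP => /(lt_trans xy); rewrite lt_irr. Qed.

Lemma chains_sub Q c d : d \subset c -> c \in chains Q -> d \in chains Q.
Proof.
rewrite !inE => dc /andP[/chainP cc cQ]; rewrite (subset_trans dc cQ) andbT.
by apply/chainP => x y /(subsetP dc) xc /(subsetP dc); apply: cc.
Qed.

Lemma chains_comparable Q c x y :
  c \in chains Q -> x \in c -> y \in c -> [|| x == y, lt x y | lt y x].
Proof. by rewrite inE => /andP[/chainP cc _]; apply: cc. Qed.

Lemma chains_in Q c x : c \in chains Q -> x \in c -> x \in Q.
Proof. by rewrite inE => /andP[_ /subsetP]; apply. Qed.

Lemma below_setU1 x d y :
  x \notin d -> below (x |: d) y = below d y + lt x y.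
Proof.
move=> xd; rewrite /below addnC; case: (boolP (lt x y)) => xy /=.
  rewrite (_ : [set _ in _ | _] = x |: [set z in d | lt z y]).
    by rewrite cardsU1 inE (negPf xd).
  by apply/setP => z; rewrite !inE; case: (eqVneq z x) => [->|] //=.
rewrite add0n; congr #|pred_of_set _|; apply/setP => z; rewrite !inE.
by case: (eqVneq z x) => [->|] //=; rewrite (negPf xy) andbF.
Qed.

Lemma below_lt c x y :
  chain c -> x \in c -> lt x y -> below c x < below c y.
Proof.
move=> cc xc xy; apply: proper_card; apply/properP; split.
  apply/subsetP => z; rewrite !inE => /andP[-> zx]; exact: lt_trans zx xy.
by exists x; rewrite !inE xc ?xy ?lt_irr.
Qed.

Lemma below_inj c : chain c -> {in c &, injective (below c)}.
Proof.
move=> cc x y xc yc e; have /or3P[/eqP//|l|l] := chainP _ cc x y xc yc.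
  by move: (below_lt cc xc l); rewrite e ltnn.
by move: (below_lt cc yc l); rewrite e ltnn.
Qed.

Section Boundary.
Variable F : fieldType.
Local Open Scope ring_scope.
Implicit Types v w : {set V} -> F.

(** The simplicial boundary of the order complex, acting on coefficient
    functions.  Each chain is oriented by its own order, so that the sign of a
    face only involves ranks and order-preserving maps act without signs. *)
Definition bd v d : F := \sum_(x | x \notin d) (-1) ^+ below d x * v (x |: d).

(** The empty chain is included: this is the vanishing of the reduced homology
    of the order complex of [Q]. *)
Definition acyclic Q := forall v,
  supported (chains Q) v -> bd v =1 (fun=> 0) ->
  exists2 w, supported (chains Q) w & bd w =1 v.

Lemma bdD v w d : bd (fun c => v c + w c) d = bd v d + bd w d.
Proof. by rewrite -big_split; apply: eq_bigr => x _; rewrite mulrDr. Qed.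

Lemma bdB v w d : bd (fun c => v c - w c) d = bd v d - bd w d.
Proof. by rewrite -sumrB; apply: eq_bigr => x _; rewrite mulrBr. Qed.

Lemma eq_bd v w : v =1 w -> bd v =1 bd w.
Proof. by move=> e d; apply: eq_bigr => x _; rewrite e. Qed.

Lemma bd_supported Q v : supported (chains Q) v -> supported (chains Q) (bd v).
Proof.
move=> sv d dQ; apply: big1 => x _; rewrite sv ?mulr0 //.
by apply: contra dQ; apply: chains_sub; apply: subsetUr.
Qed.

(** Removing [x] then [y], or [y] then [x], gives opposite signs, because
    deleting the smaller of two comparable elements lowers the rank of the
    larger one. *)
Lemma bdK Q v : supported (chains Q) v -> bd (bd v) =1 (fun=> 0).
Proof.
move=> sv d; rewrite /bd.
pose A x y := (-1) ^+ below d x * ((-1) ^+ below (x |: d) y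
                                   * v (y |: (x |: d))).
pose P x y := [&& x \notin d, y \notin d & y != x].
have -> : \sum_(x | x \notin d) (-1) ^+ below d x * \sum_(y | y \notin x |: d)
     (-1) ^+ below (x |: d) y * v (y |: (x |: d))
   = \sum_x \sum_(y | P x y && lt x y) A x y
     + \sum_x \sum_(y | P x y && lt y x) A x y.
  rewrite -big_split big_mkcond; apply: eq_bigr => x _.
  case: ifP => xd; last first.
    by rewrite !big_pred0 => [|y|y]; rewrite /= ?addr0 // /P xd.
  rewrite mulr_sumr (bigID (lt x)) /=; congr (_ + _).
    by apply: eq_bigl => y; rewrite /P xd !inE negb_or (andbC (y != x)).
  rewrite (bigID (lt^~ x)) /= [X in _ + X]big1 ?addr0.
    apply: eq_bigl => y; rewrite /P xd !inE negb_or /=.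
    case: (boolP (lt y x)) => yx; rewrite ?andbF // !andbT.
    by rewrite lt_asym // andbT andbC.
  move=> y /andP[/andP[yxd nxy] nyx]; rewrite sv ?mulr0 //.
  apply/negP => /chains_comparable/(_ (setU11 y _)) => /(_ x).
  rewrite !inE eqxx orbT (negPf nxy) (negPf nyx) !orbF => /(_ isT) yx.
  by move: yxd; rewrite !inE yx.
rewrite (exchange_big_dep predT) //= -big_split big1 // => y _ /=.
rewrite [X in X + _](eq_bigl (fun x => P y x && lt x y)); last first.
  move=> x; rewrite /P eq_sym; case: (lt x y); rewrite ?andbF // !andbT.
  by rewrite andbCA.
rewrite -big_split big1 // => x /andP[/and3P[yd xd xy] ltxy].
rewrite /A !below_setU1 // ltxy lt_asym // addn0 addn1 exprS setUCA.
rewrite mulN1r mulNr mulrN !mulrA (mulrC (_ ^+ below d y)).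
exact: addNr.
Qed.

Lemma sqr_sign n : (-1) ^+ n * (-1) ^+ n = 1 :> F.
Proof. by rewrite -expr2 sqrr_sign. Qed.

Section AddPoint.
Variables (x : V) (Q : {set V}).

Let eps d : F := (-1) ^+ below d x.
(* The coefficient of [x] in [v], as a chain of the link of [x]. *)
Let part v d := if x \in d then 0 else eps d * v (x |: d).

(** Taking the coefficient of [x] anticommutes with the boundary. *)
Lemma bd_part v d : supported (chains (x |: Q)) v -> x \notin d ->
  bd v (x |: d) = - (eps d * bd (part v) d).
Proof.
move=> sv xd; rewrite {2}/bd (bigD1 x) //= {1}/part setU11 mulr0 add0r.
rewrite mulr_sumr -sumrN /bd; apply: eq_big => [y|y].
  by rewrite !inE negb_or andbC.
rewrite !inE negb_or => /andP[yx yd]; rewrite /part !inE eq_sym (negPf yx).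
rewrite (negPf xd) /= /eps !below_setU1 // setUCA.
case: (boolP (x |: (y |: d) \in chains (x |: Q))) => [ch|/sv->]; last first.
  by rewrite !mulr0 oppr0.
have := chains_comparable ch (setU11 _ _) (setU1r x (setU11 y d)).
rewrite eq_sym (negPf yx) /= => cmp.
have -> : lt y x = ~~ lt x y.
  by case/orP: cmp => l; rewrite l lt_asym.
rewrite !exprD; set a := (-1) ^+ below d y; set b := (-1) ^+ below d x.
have bb : b * b = 1 by apply: sqr_sign.
set t := v _; have -> : b * (a * (b * (-1) ^+ (~~ lt x y) * t))
    = a * (-1) ^+ (~~ lt x y) * t.
  by rewrite (mulrA b) (mulrC b) -!mulrA (mulrA b b) bb mul1r.
by case: (lt x y); rewrite /= ?expr1 ?expr0 ?mulr1 ?mulrN1 ?mulNr ?opprK.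
Qed.

(** Joining with a point comparable to all others is a contraction. *)
Lemma acyclic_cone : x \in Q ->
  {in Q, forall y, [|| x == y, lt x y | lt y x]} -> acyclic Q.
Proof.
move=> xQ cone v sv v0.
pose w c := if x \in c then eps (c :\ x) * v (c :\ x) else 0.
have QE : x |: Q = Q by apply/setUidPr; rewrite sub1set.
have sw : supported (chains Q) w.
  move=> c cQ; rewrite /w; case: ifP => // xc; rewrite sv ?mulr0 //.
  apply: contra cQ; rewrite -{2}(setD1K xc) !inE => /andP[/chainP cc sQ].
  rewrite subUset sub1set xQ sQ !andbT; apply/chainP => y z.
  rewrite !(in_setU1 _ x) => /orP[/eqP->|yc] /orP[/eqP->|zc].
  - by rewrite eqxx.
  - by apply: cone; apply: (subsetP sQ).
  - by rewrite eq_sym [lt y x || _]orbC; apply: cone; apply: (subsetP sQ).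
  - exact: cc.
pose u c := v c - bd w c.
have su : supported (chains Q) u.
  by move=> c cQ; rewrite /u sv // (bd_supported sw) // subrr.
have u_x d : x \notin d -> u d = 0.
  move=> xd; rewrite /u /bd (bigD1 x) //= /w setU11 setU1K // mulrA sqr_sign.
  rewrite mul1r big1 ?addr0 ?subrr // => y /andP[yd yx].
  by rewrite !inE eq_sym (negPf yx) (negPf xd) mulr0.
exists w => // c; apply/esym/eqP; rewrite -subr_eq0 -/(u c).
case: (boolP (x \in c)) => [xc|/u_x->//].
have : bd u (c :\ x) = 0 by rewrite bdB v0 (bdK sw) subrr.
rewrite /bd (bigD1 x) ?setD11 //= setD1K // big1 ?addr0.
  move/(congr1 (fun t => (-1) ^+ below (c :\ x) x * t)).
  by rewrite mulrA sqr_sign mul1r mulr0 => ->.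
by move=> y /andP[_ yx]; rewrite u_x ?mulr0 // !inE eq_sym (negPf yx) eqxx.
Qed.

(** The order complex of [x |: Q] is that of [Q] with a cone glued along the
    link of [x].  A cycle is corrected by a boundary that kills its coefficient
    of [x], which is a cycle of the link; what is left is a cycle of [Q]. *)
Lemma acyclic_add_point : x \notin Q -> acyclic Q ->
  acyclic [set y in Q | lt x y || lt y x] -> acyclic (x |: Q).
Proof.
set L := [set y in Q | _] => xQ acQ acL v sv v0.
have sp : supported (chains L) (part v).
  move=> d dL; rewrite /part; case: ifP => // /negbT xd.
  rewrite sv ?mulr0 //; apply: contra dL => ch.
  have := chains_sub (subsetUr [set x] d) ch.
  rewrite !inE => /andP[-> _] /=; apply/subsetP => y yd.
  have yx : x == y = false by apply: contraNF xd => /eqP->.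
  have yd' : y \in x |: d by rewrite setU1r.
  have := chains_comparable ch (setU11 _ _) yd'.
  by have := chains_in ch yd'; rewrite !inE eq_sym yx /= => ->.
have p0 : bd (part v) =1 (fun=> 0).
  move=> d; case: (boolP (x \in d)) => xd.
    by apply: big1 => y _; rewrite /part setU1r ?mulr0.
  have := v0 (x |: d); rewrite bd_part // => /eqP; rewrite oppr_eq0 mulf_eq0.
  by rewrite signr_eq0 => /eqP.
have [b sb bE] := acL _ sp p0.
pose w c := if x \in c then eps (c :\ x) * b (c :\ x) else 0.
have sw : supported (chains (x |: Q)) w.
  move=> c cQ; rewrite /w; case: ifP => // xc; rewrite sb ?mulr0 //.
  apply: contra cQ; rewrite -{2}(setD1K xc) !inE => /andP[/chainP cc sL].
  apply/andP; split; last first.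
    apply: setUS; apply: subset_trans sL _; apply/subsetP => y.
    by rewrite inE => /andP[].
  apply/chainP => y z; rewrite !(in_setU1 _ x) => /orP[/eqP->|yc] /orP[/eqP->|zc].
  - by rewrite eqxx.
  - by have := subsetP sL z zc; rewrite inE => /andP[_ ->]; rewrite orbT.
  - have := subsetP sL y yc; rewrite inE orbC => /andP[_ ->].
    by rewrite orbT.
  - exact: cc.
have wp : part w =1 b.
  move=> d; rewrite /part /w; case: ifP => xd.
    rewrite sb // !inE; apply/negP => /andP[_ /subsetP/(_ x xd)].
    by rewrite inE (negPf xQ).
  by rewrite setU11 setU1K ?xd // mulrA sqr_sign mul1r.
pose u c := v c + bd w c.
have su : supported (chains Q) u.
  move=> c cQ; case: (boolP (x \in c)) => xc.
    rewrite /u -(setD1K xc) (bd_part sw) ?setD11 // (eq_bd wp) bE /part.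
    by rewrite setD11 mulrA sqr_sign mul1r subrr.
  have cxQ : c \notin chains (x |: Q).
    apply: contra cQ; rewrite !inE => /andP[-> /subsetP h] /=.
    apply/subsetP => y yc; move: (h y yc); rewrite !inE => /orP[/eqP e|//].
    by rewrite -e yc in xc.
  by rewrite /u sv // (bd_supported sw) // addr0.
have u0 : bd u =1 (fun=> 0) by move=> d; rewrite bdD v0 (bdK sw) addr0.
have [w2 sw2 w2E] := acQ _ su u0.
exists (fun c => w2 c - w c) => [c cQ|c]; last by rewrite bdB w2E /u addrK.
rewrite sw // subr0 sw2 //; apply: contra cQ; rewrite !inE => /andP[-> h] /=.
by apply: subset_trans h _; apply: subsetUr.
Qed.

End AddPoint.
End Boundary.
End OrderComplex.

(** * Nonevasive complexes are acyclic *)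

Section Nonevasive.
Variables (T : finType) (F : fieldType).
Implicit Types (A s t : {set T}) (D : {set {set T}}).

Definition ltp : rel {set T} := fun s t => s \proper t.

Lemma ltp_irr : irreflexive ltp.
Proof. exact: properxx. Qed.

Lemma ltp_trans : transitive ltp.
Proof. by move=> t s u; apply: proper_trans. Qed.

Definition down_closed D := forall s t, t \subset s -> s \in D -> t \in D.

Lemma sub_comparable s t :
  (s \subset t) || (t \subset s) -> [|| s == t, ltp s t | ltp t s].
Proof.
by rewrite /ltp !properEneq (eq_sym t); case: (eqVneq s t).
Qed.

Lemma down_closed_link D v : down_closed D -> down_closed (link D v).
Proof.
move=> dc s t ts; rewrite !inE => /and3P[sD vs vsD].
rewrite (dc _ _ ts sD) (dc _ _ (setUS _ ts) vsD) andbT.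
by apply: contra vs; apply: (subsetP ts).
Qed.

Lemma down_closed_deletion D v : down_closed D -> down_closed (deletion D v).
Proof.
move=> dc s t ts; rewrite !inE => /andP[sD vs]; rewrite (dc _ _ ts sD).
by apply: contra vs; apply: (subsetP ts).
Qed.

(** Induction along the decomposition tree.  The faces of the link of [v] occur
    as the faces strictly above [[set v]], which is why the statement is about
    faces translated by a disjoint set [A].  Starting from the deletion, the
    faces [v |: s] with [s] nonempty in the link are added in decreasing order:
    everything comparable to [v |: s] at that moment is comparable to [s], so its
    link is a cone.  The last point added is [[set v]], whose link is the poset of
    the faces added before it, acyclic by induction. *)
Lemma nonevasive_acyclic_shift D : nonevasive D -> down_closed D ->
  forall A, {in D, forall s, [disjoint s & A]} ->
  acyclic ltp F [set s :|: A | s in D :\ set0].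
Proof.
elim=> {D} [v|D v vD nl IHl nd IHd] dc A dis.
  apply: (acyclic_cone ltp_irr ltp_trans (x := [set v] :|: A)).
    by apply: imset_f; rewrite !inE eqxx orbT -card_gt0 cards1.
  move=> y /imsetP[s]; rewrite !inE => /andP[s0 /orP[]/eqP sE ->].
    by rewrite sE eqxx in s0.
  by rewrite sE eqxx.
have vA : v \notin A.
  by have := dis _ vD; rewrite disjoints1.
pose L := link D v; pose Q0 := [set s :|: A | s in deletion D v :\ set0].
have {IHd} ac0 : acyclic ltp F Q0.
  apply: IHd; first exact: down_closed_deletion.
  by move=> s; rewrite inE => /andP[/dis].
have {IHl} acL : acyclic ltp F [set s :|: (v |: A) | s in L :\ set0].
  apply: IHl; first exact: down_closed_link.
  move=> s; rewrite inE => /and3P[/dis sA vs _].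
  by rewrite -setI_eq0 setIUr setU_eq0 !setI_eq0 sA disjoint_sym disjoints1 vs.
have LP s : s \in L -> [/\ s \in D, v \notin s, v |: s \in D & [disjoint s & A]].
  by rewrite inE => /and3P[sD vs vsD]; split=> //; apply: dis.
have Q0P y : y \in Q0 -> exists s, [/\ y = s :|: A, s != set0, s \in D,
    v \notin s & [disjoint s & A]].
  case/imsetP => s; rewrite !inE => /and3P[s0 sD vs] ->.
  by exists s; split=> //; apply: dis.
have canA s t (B : {set T}) : [disjoint s & B] -> s :|: B \subset t :|: B -> s \subset t.
  move=> /setDidPl sB h; rewrite -sB; apply: subset_trans (setSD B _) _.
    by apply: subset_trans h; apply: subsetUl.
  by rewrite setDUl setDv setU0 subsetDl.
have disv s : s \in L -> [disjoint s & v |: A].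
  case/LP => _ vs _ sA.
  by rewrite -setI_eq0 setIUr setU_eq0 !setI_eq0 sA disjoint_sym disjoints1 vs.
pose Q (S : {set {set T}}) := Q0 :|: [set s :|: (v |: A) | s in S].
(* [S] runs over the up-closed sets of nonempty faces of the link of [v] *)
have acQ : forall n (S : {set {set T}}), #|S| <= n -> S \subset L :\ set0 ->
    (forall s t, s \in S -> t \in L -> s \subset t -> t \in S) ->
    acyclic ltp F (Q S).
  elim=> [|n IH] S.
    by rewrite leqn0 cards_eq0 => /eqP -> _ _; rewrite /Q imset0 setU0.
  move=> Sn SL up; case: (set_0Vmem S) => [->|[s0 s0S]].
    by rewrite /Q imset0 setU0.
  case: (arg_minnP (fun s : {set T} => #|s|) s0S) => s sS smin {s0 s0S}.
  have {}sS : s \in S by [].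
  have [sn0 sL] : s != set0 /\ s \in L.
    by have := subsetP SL s sS; rewrite inE => /andP[]; rewrite inE.
  have [sD vs vsD sA] := LP _ sL.
  set x := s :|: (v |: A).
  have -> : Q S = x |: Q (S :\ s).
    rewrite /Q -{1}(setD1K sS) imsetU1 setUCA //.
  have vx : v \in x by rewrite !inE eqxx orbT.
  have yS y : y \in Q (S :\ s) -> y \in Q0 \/
      exists t, [/\ y = t :|: (v |: A), t \in L, t \in S & t != s].
    rewrite inE => /orP[|/imsetP[t tS' ->]]; [by left|right; exists t].
    have [ts tS] : t != s /\ t \in S by apply/andP; rewrite -in_setD1.
    split=> //.
    by have := subsetP SL t tS; rewrite inE => /andP[].
  have vQ0 y : y \in Q0 -> v \notin y.
    by case/Q0P => t [-> _ _ vt _]; rewrite inE negb_or vt.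
  apply: (acyclic_add_point ltp_irr ltp_trans).
  - apply/negP => /yS[/vQ0|[t [xE tL tS /eqP]]]; first by rewrite vx.
    by case; apply/eqP; rewrite eqEsubset; apply/andP; split;
      apply: (canA _ _ (v |: A)); rewrite ?disv // -xE.
  - apply: IH.
    + by rewrite (cardsD1 s S) sS in Sn.
    + by apply: subset_trans SL; apply: subsetDl.
    + move=> t u; rewrite !in_setD1 => /andP[ts tS] uL tu.
      rewrite (up _ _ tS uL tu) andbT; apply: contraNneq ts => us.
      rewrite eqEcard smin // andbT -us //.
  have sAx : s :|: A \proper x.
    rewrite /x setUCA; apply: properUr.
    by rewrite sub1set inE negb_or vs.
  apply: (acyclic_cone ltp_irr ltp_trans (x := s :|: A)).
    rewrite inE /ltp sAx orbT andbT inE; apply/orP; left; apply: imset_f.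
    by rewrite !inE sn0 sD.
  move=> y; rewrite inE => /andP[/yS[yQ0|[t [yE tL tS ts]]] cmp].
    apply: sub_comparable; apply/orP; right.
    case/orP: cmp => /proper_sub h.
      by move: (vQ0 _ yQ0); rewrite (subsetP h _ vx).
    case/Q0P: yQ0 h => t [-> _ _ vt tA] h.
    rewrite subUset subsetUr andbT; apply/subsetP => z zt.
    have := subsetP h z; rewrite !inE zt => /(_ isT)/or3P[->//|/eqP zv|->].
      by rewrite -zv zt in vt.
    by rewrite orbT.
  apply: sub_comparable; apply/orP; left.
  case/orP: cmp => [xy|/proper_sub]; last first.
    rewrite yE /x => /(canA _ _ _ (disv _ tL)) h.
    by case/negP: ts; rewrite eqEcard h smin.
  exact: subset_trans (proper_sub sAx) (proper_sub xy).
set x := v |: A.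
have -> : [set s :|: A | s in D :\ set0] = x |: Q (L :\ set0).
  apply/setP => y; rewrite !inE; apply/imsetP/idP => [[s]|].
    rewrite !inE => /andP[s0 sD] ->.
    case: (boolP (v \in s)) => vs; last first.
      by apply/or3P; apply: Or32; apply: imset_f; rewrite !inE s0 sD.
    have sE : s :|: A = (s :\ v) :|: x by rewrite /x setUA (setUC (s :\ v)) setD1K.
    case: (eqVneq (s :\ v) set0) => sv; rewrite sE.
      by rewrite sv set0U eqxx.
    apply/or3P; apply: Or33; apply: imset_f; rewrite !inE sv eqxx setD1K // sD !andbT /=.
    by apply: dc sD; apply: subsetDl.
  case/or3P => [/eqP ->|/imsetP[s]|/imsetP[s]].
  - by exists [set v] => //; rewrite !inE vD -card_gt0 cards1.
  - by rewrite !inE => /and3P[s0 sD vs] ->; exists s; rewrite // !inE s0.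
  rewrite !inE => /and4P[s0 sD vs vsD] ->; exists (v |: s).
    rewrite !inE vsD andbT; apply/set0Pn; exists v; exact: setU11.
  by rewrite /x setUCA setUA.
have vx : v \in x by rewrite !inE eqxx.
apply: (acyclic_add_point ltp_irr ltp_trans).
- rewrite inE negb_or; apply/andP; split.
    by apply/negP => /Q0P[t [xE _ _ vt _]]; move: vx; rewrite xE inE (negPf vt)
      (negPf vA).
  apply/imsetP => -[t]; rewrite in_setD1 => /andP[t0 tL] xE; case/negP: t0.
  rewrite -subset0; apply: (canA _ _ (v |: A)); first exact: disv.
  by rewrite set0U -xE.
- apply: (acQ #|L :\ set0|) => // s t; rewrite !in_setD1 => /andP[s0 _] tL st.
  by rewrite tL andbT; apply: contraNneq s0 => t0; rewrite -subset0 -t0.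
rewrite (_ : [set _ in _ | _] = [set s :|: (v |: A) | s in L :\ set0]) //.
apply/setP => y; rewrite inE; apply/idP/idP; last first.
  move=> yL; rewrite !inE yL orbT /=; case/imsetP: yL => s.
  rewrite in_setD1 => /andP[s0 sL] ->; rewrite /ltp [X in X || _](_ : _ = true) //.
  rewrite properE subsetUr /=; apply: contra s0 => h.
  by rewrite -subset0; apply: (canA _ _ (v |: A)); rewrite ?disv ?set0U.
case/andP; rewrite inE => /orP[/Q0P[t [-> t0 tD vt tA]]|//].
case/orP => /proper_sub h.
  by have := subsetP h v vx; rewrite inE (negPf vt) (negPf vA).
case/negP: t0; rewrite -subset0; apply: (canA _ _ A) => //.
rewrite set0U; apply/subsetP => z zt; have := subsetP h z zt.
rewrite !inE => /orP[/eqP zv|//]; move: zt.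
by rewrite zv inE (negPf vt).
Qed.

Lemma nonevasive_acyclic D : nonevasive D -> down_closed D ->
  acyclic ltp F (D :\ set0).
Proof.
move=> ne dc; have := nonevasive_acyclic_shift ne dc (A := set0).
rewrite (eq_imset (g := id)) ?imset_id; last by move=> s; rewrite /= setU0.
by apply=> s _; rewrite -setI_eq0 setI0.
Qed.
End Nonevasive.

(** * Smith theory *)

Section CyclicPermutationModule.
Variables (X : finType) (F : fieldType) (G : X -> X) (p : nat).
Local Open Scope ring_scope.
Hypotheses (G_inj : injective G) (p_pr : prime p) (p0 : p%:R = 0 :> F).

(** The two operators of Smith theory on a permutation module for the cyclic
    group generated by [G]: the norm for [b = true], the difference operator for
    [b = false]. *)
Definition group_op (b : bool) (v : X -> F) (c : X) : F :=
  if b then \sum_(i < p) v (iter i G c) else v c - v (G c).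

Lemma group_op_fixed b v c : G c = c -> group_op b v c = 0.
Proof.
move=> Gc; case: b => /=; last by rewrite Gc subrr.
rewrite (eq_bigr (fun=> v c)); last first.
  by move=> i _; congr v; elim: (val i) => //= n ->.
by rewrite sumr_const card_ord -mulr_natl p0 mul0r.
Qed.

Variable K : {set X}.
Hypotheses (GK : forall c, (G c \in K) = (c \in K))
           (Gp : {in K, forall c, iter p G c = c}).

Lemma iter_in i c : (iter i G c \in K) = (c \in K).
Proof. by elim: i => //= i <-; rewrite GK. Qed.

Lemma group_op_supported b v : supported K v -> supported K (group_op b v).
Proof.
move=> sv c cK; rewrite /group_op; case: b.
  by apply: big1 => i _; rewrite sv // iter_in.
by rewrite !sv ?subrr // GK.
Qed.

Lemma group_opK b v : supported K v -> group_op b (group_op (~~ b) v) =1 (fun=> 0).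
Proof.
move=> sv c; case: (boolP (c \in K)) => cK; last first.
  by rewrite (group_op_supported b (group_op_supported (~~ b) sv)).
have tel : \sum_(i < p) v (iter i.+1 G c) = \sum_(i < p) v (iter i G c).
  rewrite -(big_mkord predT (fun i => v (iter i.+1 G c))).
  rewrite -(big_mkord predT (fun i => v (iter i G c))).
  apply/eqP; rewrite -subr_eq0 -sumrB telescope_sumr //.
  by rewrite Gp // subrr.
case: b => /=; first by rewrite sumrB tel subrr.
apply/eqP; rewrite subr_eq0 -tel; apply/eqP/eq_bigr => i _.
by rewrite -iterSr.
Qed.

Lemma order_free c : c \in K -> G c != c -> fingraph.order G c = p.
Proof.
move=> cK Gc.
have: (fingraph.order G c %| p)%N.
  have: iter (p %% fingraph.order G c)%N G c = c.
    have := Gp cK; rewrite {1}(divn_eq p (fingraph.order G c)) addnC iterD.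
    rewrite (_ : iter (_ * _)%N G c = c) //.
    by elim: (_ %/ _)%N => //= n IH; rewrite mulSn iterD IH iter_order.
  move/(congr1 (findex G c)); rewrite findex_iter ?ltn_mod ?order_gt0 //.
  by rewrite findex0 => /eqP.
case/primeP: p_pr => _ /[apply] /orP[]/eqP // o1.
by have := iter_order G_inj c; rewrite o1 /= => /eqP; rewrite (negPf Gc).
Qed.

Let root_in c : (froot G c \in K) = (c \in K).
Proof. by have := connect_root (frel G) c => /iter_findex <-; rewrite iter_in. Qed.

Let root_fixed c : G (froot G c) = froot G c -> G c = c.
Proof.
have := connect_root (frel G) c; rewrite fconnect_sym // => /iter_findex.
move: (findex _ _ _) => n cE Gr.
have rE : iter n G (froot G c) = froot G c by elim: n {cE} => //= n ->.
by rewrite -cE rE Gr.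
Qed.

Let root_G c : froot G (G c) = froot G c.
Proof.
by apply/eqP; rewrite (root_connect (fconnect_sym G_inj)) fconnect_sym //
  fconnect1.
Qed.

(** On the free orbits the kernel of one operator is the image of the other.
    A function whose sums over orbits vanish is the difference of its partial
    sums, counted from the root of the orbit; an invariant function is the norm
    of its restriction to the roots. *)
Lemma group_op_exact b v : supported K v -> group_op b v =1 (fun=> 0) ->
  exists2 w, supported K w &
    forall c, G c != c -> v c = group_op (~~ b) w c.
Proof.
move=> sv v0; pose r := froot G; pose j c := findex G (r c) c.
have jE c : iter (j c) G (r c) = c.
  by apply: iter_findex; rewrite fconnect_sym // connect_root.
have off w c : supported K w -> c \notin K -> v c = group_op (~~ b) w c.
  by move=> sw cK; rewrite sv // group_op_supported.
have ordr c : c \in K -> G c != c -> fingraph.order G (r c) = p.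
  move=> cK Gc; apply: order_free; first by rewrite root_in.
  by apply: contraNneq Gc => /root_fixed ->.
case: b v0 off => v0 off.
  pose w c := - \sum_(i < j c) v (iter i G (r c)).
  have sw : supported K w.
    move=> c cK; rewrite /w big1 ?oppr0 // => i _.
    by rewrite sv // iter_in root_in.
  exists w => // c Gc; case: (boolP (c \in K)) => [cK|/off]; last exact.
  have or := ordr c cK Gc; rewrite /= /w /j /r root_G -/(r c) -/(j c).
  have jp : (j c < p)%N.
    by rewrite -or findex_max // fconnect_sym // connect_root.
  have iS : iter (j c).+1 G (r c) = G c by rewrite iterS jE.
  case: (ltngtP (j c).+1 p) => [lt| |jE'].
  - rewrite -iS findex_iter ?or // opprK big_ord_recr /= jE addrA addNr.
    by rewrite add0r.
  - by rewrite ltnNge jp.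
  - have Gr : G c = r c by rewrite -iS jE' -or iter_order.
    rewrite Gr findex0 big_ord0 oppr0 subr0.
    have := v0 (r c); rewrite /= -(big_mkord predT (fun i => v (iter i G (r c)))).
    rewrite -jE' big_nat_recr //= jE big_mkord => /eqP.
    by rewrite addrC addr_eq0 => /eqP.
pose w c := if r c == c then v c else 0.
have sw : supported K w.
  by move=> c cK; rewrite /w sv // if_same.
exists w => // c Gc; case: (boolP (c \in K)) => [cK|/off]; last exact.
have vG i x : v (iter i G x) = v x.
  elim: i => //= i <-; apply/esym/eqP; rewrite -subr_eq0; apply/eqP.
  exact: v0.
have rI i : r (iter i G c) = r c by elim: i => //= i <-; apply: root_G.
have conn : fconnect G c (r c) by apply: connect_root.
have ip : (findex G c (r c) < p)%N by rewrite -(order_free cK Gc) findex_max.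
rewrite /= (bigD1 (Ordinal ip)) //= big1 => [|i ne].
  by rewrite addr0 /w rI iter_findex // eqxx -(iter_findex conn) vG.
rewrite /w rI; case: eqP => // e; case/eqP: ne; apply: val_inj => /=.
by rewrite e findex_iter // (order_free cK Gc).
Qed.

End CyclicPermutationModule.

Section MonotoneMaps.
Variables (V : finType) (lt : rel V).
Hypotheses (lt_irr : irreflexive lt) (lt_trans : transitive lt).
Variables (Q : {set V}) (f : V -> V).
Hypothesis f_mono : {in Q &, forall x y, lt x y -> (f x == f y) || lt (f x) (f y)}.

Lemma mono_inj_lt c : c \in chains lt Q -> {in c &, injective f} ->
  {in c &, forall x y, lt (f x) (f y) = lt x y}.
Proof.
move=> cQ fi x y xc yc.
have inQ z : z \in c -> z \in Q by apply: chains_in cQ.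
have up : {in c &, forall z t, lt z t -> lt (f z) (f t)}.
  move=> z t zc tc zt; have := f_mono (inQ z zc) (inQ t tc) zt.
  case/orP=> // /eqP /(fi _ _ zc tc) e; by rewrite e lt_irr in zt.
have /or3P[/eqP ->|xy|yx] := chains_comparable cQ xc yc.
- by rewrite !lt_irr.
- by rewrite xy up.
- rewrite (lt_asym lt_irr lt_trans yx).
  by rewrite (lt_asym lt_irr lt_trans (up _ _ yc xc yx)).
Qed.

Lemma below_imset c (d : {set V}) x : c \in chains lt Q -> {in c &, injective f} ->
  d \subset c -> x \in c -> below lt (f @: d) (f x) = below lt d x.
Proof.
move=> cQ fi dc xc; have sd := subsetP dc.
rewrite /below -(card_in_imset (f := f) (D := [set y in d | lt y x])); last first.
  move=> y z; rewrite !inE => /andP[/sd yc _] /andP[/sd zc _]; exact: fi.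
congr #|pred_of_set _|; apply/setP => y; rewrite !inE; apply/andP/imsetP.
  case=> /imsetP[z zd ->]; rewrite (mono_inj_lt cQ fi (sd _ zd) xc) => zx.
  by exists z; rewrite // inE zd.
case=> z; rewrite inE => /andP[zd zx] ->; rewrite imset_f //.
by rewrite (mono_inj_lt cQ fi (sd _ zd) xc).
Qed.

(** A monotone map that permutes a chain preserves ranks, which separate the
    elements of a chain.  This is what makes the action on an order complex
    regular. *)
Lemma chain_fixed_pointwise c : c \in chains lt Q -> f @: c = c ->
  {in c, forall x, f x = x}.
Proof.
move=> cQ fc x xc.
have fi : {in c &, injective f} by apply/imset_injP; rewrite fc.
have ch : chain lt c by move: cQ; rewrite inE => /andP[].
have fxc : f x \in c by rewrite -[in X in _ \in X]fc imset_f.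
apply: (below_inj lt_irr lt_trans ch) => //.
by rewrite -{1}fc (below_imset cQ).
Qed.

Lemma chains_fixed c :
  (c \in chains lt [set x in Q | f x == x]) =
  (c \in chains lt Q) && (f @: c == c).
Proof.
apply/idP/andP => [|[cQ /eqP fc]].
  rewrite !inE => /andP[-> /subsetP h] /=; split.
    by apply/subsetP => x /h; rewrite inE => /andP[].
  apply/eqP; rewrite -[RHS]imset_id; apply: eq_in_imset => x /h.
  by rewrite inE => /andP[_ /eqP].
have pt := chain_fixed_pointwise cQ fc.
move: cQ; rewrite !inE => /andP[-> /subsetP h] /=; apply/subsetP => x xc.
by rewrite inE h //= pt.
Qed.

End MonotoneMaps.

Section Smith.
Variables (V : finType) (lt : rel V).
Hypotheses (lt_irr : irreflexive lt) (lt_trans : transitive lt).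
Variables (F : fieldType) (p : nat).
Hypotheses (p_pr : prime p) (p0 : (p%:R = 0 :> F)%R).
Variables (Q : {set V}) (g : V -> V).
Hypotheses (g_inj : injective g) (g_lt : forall x y, lt (g x) (g y) = lt x y)
  (gQ : {in Q, forall x, g x \in Q}) (gp : {in Q, forall x, iter p g x = x}).
Local Open Scope ring_scope.
Implicit Types (c d : {set V}) (v w : {set V} -> F).

Let G c := g @: c.
Let G_inj : injective G := imset_inj g_inj.

Let g_mono : {in Q &, forall x y, lt x y -> (g x == g y) || lt (g x) (g y)}.
Proof. by move=> x y _ _ xy; rewrite g_lt xy orbT. Qed.

Let g_in x : (g x \in Q) = (x \in Q).
Proof.
have gQE : g @: Q = Q.
  apply/eqP; rewrite eqEcard card_imset // leqnn andbT.
  by apply/subsetP => _ /imsetP[y yQ ->]; apply: gQ.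
by rewrite -{1}gQE mem_imset.
Qed.

Let G_chains c : (G c \in chains lt Q) = (c \in chains lt Q).
Proof.
rewrite !inE; congr andb.
  apply/chainP/chainP => ch x y xc yc.
    have := ch _ _ (imset_f g xc) (imset_f g yc).
    by rewrite !g_lt (inj_eq g_inj).
  case/imsetP: xc => z zc ->; case/imsetP: yc => t tc ->.
  by rewrite !g_lt (inj_eq g_inj); apply: ch.
apply/subsetP/subsetP => h x.
  by move=> xc; rewrite -g_in h // imset_f.
by case/imsetP => y yc ->; rewrite g_in h.
Qed.

Let Gp : {in chains lt Q, forall c, iter p G c = c}.
Proof.
move=> c cQ; have it n : iter n G c = [set iter n g x | x in c].
  elim: n => [|n IH] /=; first by rewrite imset_id.
  by rewrite IH /G -imset_comp.
rewrite it -[RHS]imset_id; apply: eq_in_imset => x xc.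
by apply: gp; apply: chains_in cQ xc.
Qed.

Let bd_G v d : bd lt (fun c => v (G c)) d = bd lt v (G d).
Proof.
rewrite /bd [RHS](reindex_inj g_inj) /=; apply: eq_big => [x|x xd].
  by rewrite mem_imset.
rewrite /G imsetU1 /below; congr (_ ^+ _ * _).
rewrite -(card_imset [set y in d | lt y x] g_inj).
congr #|pred_of_set _|; apply/setP => y; rewrite !inE; apply/imsetP/andP.
  case=> z; rewrite inE => /andP[zd zx] ->; by rewrite g_lt imset_f.
case=> /imsetP[z zd ->]; rewrite g_lt => zx; by exists z; rewrite // inE zd.
Qed.

Let op := group_op (F := F) G p.

Let bd_op b v d : bd lt (op b v) d = op b (bd lt v) d.
Proof.
have it n c : bd lt (fun c => v (iter n G c)) c = bd lt v (iter n G c).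
  elim: n c => //= n IH c.
  rewrite -iterS iterSr -IH -bd_G; apply: eq_bd => e.
  by rewrite -iterSr.
case: b; rewrite /op /group_op; last by rewrite bdB bd_G.
rewrite /bd; under eq_bigr do rewrite mulr_sumr.
by rewrite exchange_big; apply: eq_bigr => i _; apply: it.
Qed.

(* Chains of at least [k] elements: the induction below runs downward in [k]. *)
Let upto k := [set c in chains lt Q | (k <= #|c|)%N].

Let G_upto k c : (G c \in upto k) = (c \in upto k).
Proof. by rewrite [in LHS]inE [in RHS]inE G_chains card_imset. Qed.

Let Gp_upto k : {in upto k, forall c, iter p G c = c}.
Proof. by move=> c; rewrite inE => /andP[/Gp]. Qed.

Let upto_chains k v : supported (upto k) v -> supported (chains lt Q) v.
Proof. by move=> sv c cQ; apply: sv; rewrite inE (negPf cQ). Qed.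

(* The component of [v] along the invariant chains. *)
Let fx v c := if G c == c then v c else 0.

Let bd_fx v d : supported (chains lt Q) v -> G d != d -> bd lt (fx v) d = 0.
Proof.
move=> sv Gd; apply: big1 => x xd; rewrite /fx; case: eqP => [Gx|]; last first.
  by rewrite mulr0.
rewrite sv ?mulr0 //; apply: contra Gd => ch.
have fixd y : y \in d -> g y = y.
  move=> yd; apply: (chain_fixed_pointwise lt_irr lt_trans g_mono ch Gx).
  by rewrite setU1r.
apply/eqP; rewrite -[RHS]imset_id; exact: eq_in_imset.
Qed.

Let split_op b w z : (forall c, G c != c -> z c = op b w c) ->
  z =1 (fun c => op b w c + fx z c).
Proof.
move=> h c; rewrite /fx; case: eqP => [Gc|/eqP Gc].
  by rewrite /op group_op_fixed // add0r.
by rewrite addr0 h.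
Qed.

Let bd_truncate k (y : {set V} -> F) d :
  bd lt (fun c => if (k < #|c|)%N then y c else 0) d =
  if (k <= #|d|)%N then bd lt y d else 0.
Proof.
rewrite /bd; case: ifP => kd; last first.
  by apply: big1 => x xd; rewrite cardsU1 xd add1n ltnS kd mulr0.
by apply: eq_bigr => x xd; rewrite cardsU1 xd add1n ltnS kd.
Qed.

Hypothesis acQ : acyclic lt F Q.

(** The kernel of each operator is the sum of the image of the other one and of
    the chains fixed by [g].  A cycle [v] of that kernel bounds some [y], and
    [op b y] is a cycle of the other kernel, supported on longer chains; by
    induction it is [op b] of a boundary, and subtracting this boundary from [y]
    puts it in the kernel. *)
Let ker_op_exact b k v : supported (upto k) v -> op b v =1 (fun=> 0) ->
  bd lt v =1 (fun=> 0) ->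
  exists w, [/\ supported (upto k.+1) w, op b w =1 (fun=> 0) & bd lt w =1 v].
Proof.
have [n] := ubnP (#|V|.+1 - k)%N; elim: n => // n IH in b k v *.
rewrite ltnS => kn sv opv bdv.
have [kV|Vk] := leqP k #|V|; last first.
  exists (fun=> 0); split=> // c.
  - by case: (b); rewrite /op /group_op ?subrr // big1.
  - rewrite sv; first by apply: big1 => x _; rewrite mulr0.
    rewrite inE negb_and -ltnNge (leq_ltn_trans _ Vk) ?orbT //.
    exact: max_card.
have [y0 sy0 y0E] := acQ (upto_chains sv) bdv.
pose y c := if (k < #|c|)%N then y0 c else 0.
have sy : supported (upto k.+1) y.
  by move=> c; rewrite inE /y; case: ltnP => // _; rewrite andbT => /sy0.
have yE : bd lt y =1 v.
  move=> d; rewrite bd_truncate; case: ifP => kd; first exact: y0E.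
  by rewrite sv // inE kd andbF.
pose u := op b y.
have su : supported (upto k.+1) u by apply: group_op_supported; last exact: sy; exact: G_upto.
have bdu : bd lt u =1 (fun=> 0).
  by move=> d; rewrite bd_op -(opv d); case: (b); rewrite /op /group_op ?yE //;
     apply: eq_bigr => i _; rewrite yE.
have opu : op (~~ b) u =1 (fun=> 0).
  have := group_opK (@G_upto k.+1) (@Gp_upto k.+1) (~~ b) sy.
  by rewrite negbK.
have k1n : (#|V|.+1 - k.+1 < n)%N.
  by apply: leq_trans kn; rewrite subnS prednK // subn_gt0 ltnS.
have [z [sz opz zE]] := IH (~~ b) k.+1 u k1n su opu bdu.
have [w sw zw] := group_op_exact G_inj p_pr (@G_upto _) (@Gp_upto _) sz opz.
rewrite negbK in zw.
have zS := split_op zw.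
have szc := upto_chains sz.
have bdfz c : bd lt (fx z) c = 0.
  case: (eqVneq (G c) c) => Gc; last exact: bd_fx.
  have := zE c; rewrite (eq_bd lt zS) bdD bd_op /u /op.
  by rewrite !group_op_fixed // add0r.
have uE : u =1 op b (bd lt w).
  by move=> c; rewrite -zE (eq_bd lt zS) bdD bdfz addr0 bd_op.
have sbw : supported (upto k.+1) (bd lt w).
  move=> d; rewrite inE negb_and => /orP[dQ|kd].
    exact: (bd_supported (upto_chains sw)).
  rewrite /bd big1 // => x xd; rewrite sw ?mulr0 // inE cardsU1 xd add1n ltnS.
  by rewrite (negPf kd) andbF.
exists (fun c => y c - bd lt w c); split.
- by move=> c cK; rewrite sy // sbw // subrr.
- move=> c; have := uE c; rewrite /u /op /group_op.
  case: (b) => /eqP; rewrite -subr_eq0 => /eqP uE0; first by rewrite sumrB.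
  by apply: etrans uE0; rewrite !opprB addrACA [RHS]addrACA (addrC (- _)).
- by move=> c; rewrite bdB (bdK lt_irr lt_trans (upto_chains sw)) subr0 yE.
Qed.

(** Smith theorem: a cycle made of fixed chains bounds some [y] in the kernel of
    the difference operator, and the norm part of [y] does not contribute to the
    fixed chains of its boundary. *)
Theorem smith : acyclic lt F [set x in Q | g x == x].
Proof.
set Qg := [set x in Q | _] => v sv bdv.
have chg c : c \in chains lt Qg = (c \in chains lt Q) && (G c == c).
  exact: chains_fixed.
have fxv : fx v =1 v.
  by move=> c; rewrite /fx; case: eqP => // /eqP Gc; rewrite sv // chg (negPf Gc) andbF.
have sv0 : supported (upto 0) v.
  by move=> c cQ; rewrite sv // chg; apply: contra cQ => /andP[cQ _]; rewrite in_set cQ.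
have opv : op false v =1 (fun=> 0).
  move=> c; case: (eqVneq (G c) c) => Gc; first exact: group_op_fixed.
  rewrite /op /group_op -!fxv /fx (negPf Gc) (inj_eq G_inj) (negPf Gc).
  by rewrite subrr.
have [y [sy opy yE]] := ker_op_exact sv0 opv bdv.
have [w sw yw] := group_op_exact G_inj p_pr (@G_upto _) (@Gp_upto _) sy opy.
have yS := split_op yw.
exists (fx y).
  move=> c; rewrite chg negb_and /fx => /orP[cQ|/negPf->//].
  by rewrite (upto_chains sy) // if_same.
move=> c; case: (eqVneq (G c) c) => Gc.
  by rewrite -yE (eq_bd lt yS) bdD bd_op /op group_op_fixed // add0r.
by rewrite bd_fx // -?fxv /fx ?(negPf Gc) //; apply: upto_chains sy.
Qed.
End Smith.

(** * The Lefschetz fixed point formula *)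

Section Lefschetz.
Variables (V : finType) (lt : rel V).
Hypotheses (lt_irr : irreflexive lt) (lt_trans : transitive lt).
Variables (Q : {set V}) (f : V -> V).
Hypotheses (fQ : {in Q, forall x, f x \in Q})
  (f_mono : {in Q &, forall x y, lt x y -> (f x == f y) || lt (f x) (f y)}).
Local Open Scope ring_scope.
Implicit Types (c d : {set V}).

Definition incidence c d : int :=
  \sum_(x in c | c :\ x == d) (-1) ^+ below lt c x.

(** The matrix of the chain map induced by [f]: a chain that [f] collapses is
    sent to zero. *)
Definition push_coef c d : int := ((#|f @: c| == #|c|) && (f @: c == d))%:R.

Lemma sum_incidence (R : comPzRingType) c (phi : {set V} -> R) :
  c \in chains lt Q ->
  \sum_(d in chains lt Q) (incidence c d)%:~R * phi d =
  \sum_(x in c) (-1) ^+ below lt c x * phi (c :\ x).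
Proof.
move=> cQ; rewrite /incidence.
under eq_bigr do rewrite rmorph_sum mulr_suml big_mkcondr /=.
rewrite exchange_big; apply: eq_bigr => x xc /=.
rewrite (bigD1 (c :\ x)) /=; last by apply: chains_sub cQ; apply: subsetDl.
rewrite eqxx rmorphXn rmorphN1 big1 ?addr0 // => d /andP[_ /negPf].
by rewrite eq_sym => ->.
Qed.

Lemma bd_incidence (F : fieldType) (v : {set V} -> F) d :
  supported (chains lt Q) v ->
  bd lt v d = \sum_(c in chains lt Q) v c * (incidence c d)%:~R.
Proof.
move=> sv; rewrite /incidence.
under [RHS]eq_bigr do rewrite rmorph_sum mulr_sumr /=.
rewrite (exchange_big_dep predT) //= /bd big_mkcond; apply: eq_bigr => x _.
case: ifP => xd; last first.
  rewrite big1 // => c /and3P[_ xc /eqP cd]; move: xd.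
  by rewrite -cd setD11.
case: (boolP ((x |: d) \in chains lt Q)) => ch; last first.
  rewrite sv // mulr0 big1 // => c /and3P[cQ xc /eqP cd].
  by rewrite -cd setD1K // cQ in ch.
rewrite (bigD1 (x |: d)) /=; last by rewrite ch setU11 setU1K ?eqxx ?xd.
rewrite below_setU1 ?xd // lt_irr addn0 rmorphXn rmorphN1 mulrC big1 ?addr0 //.
by move=> c /andP[/and3P[cQ xc /eqP <-]]; rewrite setD1K // eqxx.
Qed.

Lemma incidenceK : {in chains lt Q &, forall c e,
  \sum_(d in chains lt Q) incidence c d * incidence d e = 0}.
Proof.
move=> c e cQ eQ; pose v d : rat := (d == c)%:R.
have sv : supported (chains lt Q) v.
  by move=> d dQ; rewrite /v; case: eqP => // dc; rewrite dc cQ in dQ.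
have bdv d : bd lt v d = (incidence c d)%:~R.
  rewrite bd_incidence // (bigD1 c) //= /v eqxx mul1r big1 ?addr0 // => i.
  by case/andP=> _ /negPf->; rewrite mul0r.
have := bdK lt_irr lt_trans sv e.
rewrite bd_incidence; last exact: bd_supported.
under eq_bigr do rewrite bdv -rmorphM.
by rewrite -rmorph_sum => /eqP; rewrite intr_eq0 => /eqP.
Qed.

(** Only the case where [f] collapses the chain [c] is not a reindexing.  Then at
    most two faces of [c] are not collapsed: those omitting [x] or [y], when [x]
    and [y] are consecutive and [x], [y] is the only pair with the same image.
    These two faces have the same image and opposite signs. *)
Lemma push_incidence : {in chains lt Q &, forall c e,
  \sum_(d in chains lt Q) incidence c d * push_coef d e =
  \sum_(d in chains lt Q) push_coef c d * incidence d e}.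
Proof.
move=> c e cQ eQ; rewrite -[LHS]/(\sum_(d in _) (_ : int) * _).
under eq_bigr do rewrite -[incidence _ _]intz.
rewrite sum_incidence //.
have inQ x : x \in c -> x \in Q by apply: chains_in cQ.
have ch : chain lt c by move: cQ; rewrite inE => /andP[].
case: (boolP (#|f @: c| == #|c|)) => injc; last first.
  rewrite [RHS]big1 => [|d _]; last by rewrite /push_coef (negPf injc) mul0r.
  have [x [y [xc yc xy fxy]]] :
      exists x y, [/\ x \in c, y \in c, lt x y & f x = f y].
    have : ~ {in c &, injective f} by move=> /imset_injP h; rewrite h in injc.
    move=> ninj; case: (boolP [exists x in c, exists y in c, lt x y && (f x == f y)]).
      case/exists_inP => x xc /exists_inP[y yc /andP[xy /eqP fxy]].
      by exists x, y.
    move=> nex; case: ninj => x y xc yc fxy; apply/eqP; apply: contraNT nex => nxy.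
    have := chains_comparable cQ xc yc; rewrite (negPf nxy) /= => /orP[l|l].
      apply/exists_inP; exists x => //; apply/exists_inP; exists y => //.
      by rewrite l fxy eqxx.
    apply/exists_inP; exists y => //; apply/exists_inP; exists x => //.
    by rewrite l fxy eqxx.
  have nxy : x != y by apply: contraTneq xy => ->; rewrite lt_irr.
  have push0 z t1 t2 : t1 \in c -> t2 \in c -> t1 != z -> t2 != z -> t1 != t2 ->
      f t1 = f t2 -> push_coef (c :\ z) e = 0.
    move=> t1c t2c t1z t2z t12 ft; rewrite /push_coef.
    case: eqP => //= /eqP/imset_injP h.
    by rewrite (h t1 t2) ?inE ?t1z ?t2z ?eqxx // in t12.
  rewrite (bigD1 x) //= (bigD1 y) /=; last by rewrite yc eq_sym.
  rewrite [X in _ + (_ + X)]big1 ?addr0; last first.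
    move=> z /andP[/andP[zc zx] zy].
    by rewrite (push0 z x y) ?mulr0 // eq_sym.
  case: (boolP [exists z in c, lt x z && lt z y]) => [/exists_inP[z zc /andP[xz zy]]|nz].
    have fz : f x = f z.
      have := f_mono (inQ x xc) (inQ z zc) xz; have := f_mono (inQ z zc) (inQ y yc) zy.
      rewrite fxy => /orP[/eqP -> //|l1] /orP[/eqP ->//|l2].
      by move: (lt_trans l1 l2); rewrite lt_irr.
    have zx : z != x by apply: contraTneq xz => ->; rewrite lt_irr.
    have zy' : z != y by apply: contraTneq zy => ->; rewrite lt_irr.
    rewrite (push0 x y z) ?(push0 y x z) ?mulr0 ?addr0 // 1?eq_sym //.
    by rewrite -fxy.
  have bE : below lt c y = (below lt c x).+1.
    rewrite /below (_ : [set z in c | lt z y] = x |: [set z in c | lt z x]).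
      by rewrite cardsU1 inE lt_irr andbF.
    apply/setP => z; rewrite !inE; apply/andP/orP.
      case=> zc zy; case: (eqVneq z x) => [|zx]; [by left|right].
      rewrite zc /=; have := chains_comparable cQ zc xc.
      rewrite (negPf zx) /= => /orP[//|xz]; case/negP: nz.
      by apply/exists_inP; exists z => //; rewrite xz.
    case=> [/eqP ->|/andP[zc zx]]; first by rewrite xc.
    by rewrite zc (lt_trans zx).
  have imE : f @: (c :\ x) = f @: (c :\ y).
    have sub a b : a \in c -> b \in c -> a != b -> f a = f b ->
        f @: (c :\ a) \subset f @: (c :\ b).
      move=> ac bc ab fab; apply/subsetP => _ /imsetP[z zi ->].
      move: zi; rewrite !inE => /andP[za zc].
      case: (eqVneq z b) => [->|zb].
        by rewrite -fab imset_f // !inE ab ac.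
      by rewrite imset_f // !inE zb zc.
    by apply/eqP; rewrite eqEsubset !sub // eq_sym.
  have cE : #|c :\ x| = #|c :\ y|.
    have := cardsD1 y c; rewrite (cardsD1 x c) xc yc => /eqP.
    by rewrite eqn_add2l => /eqP.
  by rewrite /push_coef imE cE bE exprS mulN1r mulNr addrN.
have fi : {in c &, injective f} by apply/imset_injP.
have fcQ : f @: c \in chains lt Q.
  rewrite inE; apply/andP; split.
    apply/chainP => _ _ /imsetP[x xc ->] /imsetP[y yc ->].
    have := chains_comparable cQ xc yc.
    case/or3P => [/eqP->|l|l]; rewrite ?eqxx //.
      by rewrite orbA f_mono ?inQ.
    by rewrite eq_sym orbCA f_mono ?inQ ?orbT.
  by apply/subsetP => _ /imsetP[x /inQ xQ ->]; apply: fQ.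
rewrite [RHS](bigD1 (f @: c)) //= [X in _ = _ + X]big1 ?addr0; last first.
  move=> d /andP[_ /negPf dc].
  by rewrite /push_coef [X in _ && X]eq_sym dc andbF mul0r.
rewrite /push_coef injc eqxx mul1r /incidence big_mkcondr big_imset //=.
apply: eq_bigr => x xc.
rewrite (below_imset lt_irr lt_trans f_mono cQ fi (subxx c) xc).
have -> : (f @: c) :\ f x = f @: (c :\ x).
  apply/setP => y; rewrite !inE; apply/andP/imsetP => [[yfx /imsetP[z zc yz]]|].
    exists z => //; rewrite !inE zc andbT; apply: contraNneq yfx => <-.
    by rewrite yz.
  case=> z; rewrite !inE => /andP[zx zc] ->; rewrite imset_f //; split=> //.
  by apply: contraNneq zx => /(fi _ _ zc xc) ->.
have -> : #|f @: (c :\ x)| == #|c :\ x|.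
  apply/imset_injP => y z; rewrite !inE => /andP[_ yc] /andP[_ zc]; exact: fi.
by case: eqP => _; rewrite /= ?mulr1 ?mulr0.
Qed.

(** The diagonal coefficients of the chain map count the chains permuted by [f],
    which are the chains of fixed points; their alternating sum is a super-trace
    on an exact complex.  As the empty chain is counted, the result says that
    the fixed points have reduced Euler characteristic zero. *)
Theorem lefschetz p : prime p -> acyclic lt 'F_p Q ->
  \sum_(c in chains lt [set x in Q | f x == x]) (-1) ^+ #|c| = 0 :> int.
Proof.
move=> p_pr acQ; pose par c := odd #|c|.
have tr : \sum_(c in chains lt Q) (-1) ^+ par c * push_coef c c = 0.
  apply: (hopf_trace p_pr (D := incidence)).
  - move=> c d cQ dQ pcd; rewrite /incidence big1 // => x /andP[xc /eqP cd].
    by move: pcd; rewrite /par (cardsD1 x) xc cd /=; case: odd.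
  - exact: incidenceK.
  - exact: push_incidence.
  move=> v v0; pose v' c := if c \in chains lt Q then v c else 0.
  have sv : supported (chains lt Q) v' by move=> c /negPf; rewrite /v' => ->.
  have v'E d : bd lt v' d = \sum_(c in chains lt Q) v c * (incidence c d)%:~R.
    by rewrite bd_incidence //; apply: eq_bigr => c cQ; rewrite /v' cQ.
  have bd0 : bd lt v' =1 (fun=> 0).
    move=> d; case: (boolP (d \in chains lt Q)) => dQ; first by rewrite v'E v0.
    exact: (bd_supported sv).
  have [w sw wE] := acQ v' sv bd0.
  by exists w => d dQ; rewrite -bd_incidence // wE /v' dQ.
rewrite -[RHS]tr [RHS](bigID (fun c => f @: c == c)) /=.
rewrite [X in _ + X]big1 ?addr0 => [|c /andP[_ /negPf h]]; last first.
  by rewrite /push_coef h andbF mulr0.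
apply: eq_big => [c|c]; rewrite chains_fixed // => /andP[_ /eqP fc].
by rewrite /push_coef fc !eqxx mulr1 /par signr_odd.
Qed.
End Lefschetz.

(** * Euler characteristics of posets of unions of blocks *)

Section EulerCharacteristic.
Local Open Scope ring_scope.

Lemma big_subset_setU1 (J : finType) (R : nmodType) (j : J) (S : {set J})
    (phi : {set J} -> R) : j \notin S ->
  \sum_(m : {set J} | m \subset j |: S) phi m =
  \sum_(m : {set J} | m \subset S) phi m +
  \sum_(m : {set J} | m \subset S) phi (j |: m).
Proof.
move=> jS; rewrite (bigID (fun m : {set J} => j \in m)) /= addrC; congr (_ + _).
  apply: eq_bigl => m; apply/andP/idP => [[h jm]|mS].
    apply/subsetP => x xm; have := subsetP h x xm; rewrite !inE.
    by case: eqP => // e; rewrite -e xm in jm.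
  split; first by apply: subset_trans mS _; apply: subsetUr.
  by apply: contra jS; apply: (subsetP mS).
rewrite (reindex_onto (fun m => j |: m) (fun m => m :\ j)) /=; last first.
  by move=> m /andP[_ jm]; rewrite setD1K.
apply: eq_bigl => m; rewrite setU11 andbT; apply/andP/idP => [[h /eqP e]|mS].
  apply/subsetP => x xm; have := subsetP h x; rewrite !inE xm orbT => /(_ isT).
  case/orP => // /eqP xj; move: xm; rewrite -e xj !inE eqxx //.
by rewrite setUS // setU1K // (contra _ jS) //; apply: (subsetP mS).
Qed.

Lemma sum_sign_subsets (J : finType) (S : {set J}) : S != set0 ->
  \sum_(m : {set J} | m \subset S) (-1) ^+ #|m| = 0 :> int.
Proof.
case/set0Pn => j jS; rewrite -(setD1K jS) big_subset_setU1 ?setD11 //.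
rewrite -big_split big1 // => m mS /=.
have jm : j \notin m.
  by apply/negP => /(subsetP mS); rewrite setD11.
by rewrite cardsU1 jm exprS mulN1r addrN.
Qed.

Variables (V : finType) (lt : rel V).
Hypotheses (lt_irr : irreflexive lt) (lt_trans : transitive lt).

Definition chain_sum (Q : {set V}) : int :=
  \sum_(c in chains lt Q) (-1) ^+ #|c|.

(** The chains through a maximal element [x] are [x] added to a chain of
    elements smaller than [x]. *)
Lemma chain_sum_max x (Q : {set V}) :
  x \notin Q -> {in Q, forall y, ~~ lt x y} ->
  chain_sum (x |: Q) = chain_sum Q - chain_sum [set y in Q | lt y x].
Proof.
move=> xQ xmax; rewrite /chain_sum (bigID (fun c : {set V} => x \in c)) /= addrC.
congr (_ + _).
  apply: eq_bigl => c; rewrite !inE -andbA; congr andb.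
  apply/andP/idP => [[h xc]|cQ].
    apply/subsetP => y yc; have := subsetP h y yc; rewrite !inE.
    by case: eqP => // e; rewrite -e yc in xc.
  split; first by apply: subset_trans cQ _; apply: subsetUr.
  by apply: contra xQ; apply: (subsetP cQ).
rewrite (reindex_onto (fun c => x |: c) (fun c => c :\ x)) /=; last first.
  by move=> c /andP[_ xc]; rewrite setD1K.
rewrite -sumrN; apply: eq_big => [c|c /andP[/andP[ch _] /eqP e]]; last first.
  have xc : x \notin c by rewrite -e setD11.
  by rewrite cardsU1 xc exprS mulN1r.
rewrite setU11 andbT; apply/andP/idP => [[ch /eqP e]|].
  have xc : x \notin c by rewrite -e setD11.
  have := chains_sub (subsetUr [set x] c) ch.
  rewrite !inE => /andP[-> _] /=; apply/subsetP => y yc; rewrite inE.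
  have yx : x == y = false by apply: contraNF xc => /eqP->.
  have yxc : y \in x |: c by rewrite setU1r.
  have := chains_in ch yxc; rewrite !inE eq_sym yx /= => yQ.
  have := chains_comparable ch (setU11 _ _) yxc.
  by rewrite yx (negPf (xmax y yQ)) yQ.
rewrite inE => /andP[/chainP ch /subsetP cL].
have xc : x \notin c.
  by apply/negP => /cL; rewrite inE (negPf xQ).
rewrite setU1K // eqxx; split=> //; rewrite inE; apply/andP; split.
  apply/chainP => y z; rewrite !(in_setU1 _ x).
  move=> /orP[/eqP->|yc] /orP[/eqP->|zc]; rewrite ?eqxx //.
  - by have := cL z zc; rewrite inE => /andP[_ ->]; rewrite !orbT.
  - by have := cL y yc; rewrite inE => /andP[_ ->]; rewrite !orbT.
  - exact: ch.
by apply: setUS; apply/subsetP => y /cL; rewrite inE => /andP[].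
Qed.

(** Barycentric subdivision does not change the Euler characteristic: the faces
    are removed one by one from the top, and the proper faces of a nonempty [m0]
    contribute [- (-1) ^+ #|m0|]. *)
Lemma chain_sum_faces (J : finType) (e : {set J} -> V) (K : {set {set J}}) :
  injective e -> (forall m m', lt (e m) (e m') = (m \proper m')) ->
  set0 \in K -> down_closed K ->
  chain_sum (e @: (K :\ set0)) = \sum_(m in K) (-1) ^+ #|m|.
Proof.
move=> e_inj e_lt; have [n] := ubnP #|K|; elim: n => // n IH in K *.
rewrite ltnS => Kn K0 dc.
case: (arg_maxnP (fun m : {set J} => #|m|) K0) => m0 m0K m0max.
have {}m0K : m0 \in K by [].
case: (eqVneq m0 set0) => m00.
  have -> : K = [set set0].
    apply/setP => m; rewrite inE; apply/idP/eqP => [mK|-> //].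
    by have := m0max m mK; rewrite m00 cards0 => /leq_trans/(_ (leq0n 0));
       rewrite leqn0 cards_eq0 => /eqP.
  rewrite setDv imset0 big_set1 cards0 /chain_sum (big_pred1 set0) ?cards0 //.
  move=> c; rewrite inE subset0 /=; case: eqP => [->|]; rewrite ?andbF //.
  by rewrite andbT; apply/chainP => y z; rewrite inE.
have KD : K :\ set0 = m0 |: ((K :\ m0) :\ set0).
  apply/setP => m; rewrite !inE.
  by case: (eqVneq m m0) => [->|]; rewrite ?m00 ?m0K.
have maxm m : m \in K -> ~~ (m0 \proper m).
  move=> mK; apply/negP => /proper_card; rewrite ltnNge => /negP; apply.
  exact: m0max.
have KmE : #|K| = #|K :\ m0|.+1 by rewrite (cardsD1 m0) m0K.
rewrite KD imsetU1 chain_sum_max.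
- rewrite (IH (K :\ m0)); last 3 first.
  + by rewrite -KmE.
  + by rewrite !inE eq_sym m00.
  + move=> s t ts; rewrite !inE => /andP[sm sK]; rewrite (dc s t ts sK) andbT.
    apply: contraNneq sm => tm; rewrite -tm in maxm *; rewrite eq_sym eqEsubset ts.
    by have := maxm s sK; rewrite properE ts /= negbK.
  pose K' := [set m : {set J} | m \proper m0].
  have -> : [set y in e @: ((K :\ m0) :\ set0) | lt y (e m0)] = e @: (K' :\ set0).
    apply/setP => y; rewrite inE; apply/andP/imsetP.
      case=> /imsetP[m]; rewrite !inE => /and3P[m0' _ mK] ->; rewrite e_lt => mp.
      by exists m; rewrite // !inE m0'.
    case=> m; rewrite !inE => /andP[m0' mp] ->; rewrite e_lt mp; split=> //.
    apply: imset_f; rewrite !inE m0' (dc _ _ (proper_sub mp) m0K) andbT /=.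
    by apply: contraTneq mp => ->; rewrite properxx.
  rewrite (IH K'); last 3 first.
  + apply: leq_trans Kn; rewrite KmE ltnS; apply: subset_leq_card.
    apply/subsetP => m; rewrite !inE => mp; rewrite (dc _ _ (proper_sub mp) m0K).
    by rewrite andbT; apply: contraTneq mp => ->; rewrite properxx.
  + by rewrite inE properE sub0set subset0.
  + by move=> s t ts; rewrite !inE; apply: sub_proper_trans.
  have := sum_sign_subsets m00; rewrite (bigD1 m0) //= => /eqP.
  rewrite addr_eq0 => /eqP s0.
  rewrite [RHS](bigD1 m0) //= s0 [RHS]addrC; congr (_ - _).
    by apply: eq_bigl => m; rewrite !inE andbC.
  by apply: eq_bigl => m; rewrite inE properEneq andbC.
- by apply/imsetP => -[m]; rewrite !inE => /and3P[_ mm _] /e_inj m0E; rewrite m0E eqxx in mm.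
move=> y /imsetP[m]; rewrite !inE => /and3P[_ _ mK] ->.
by rewrite e_lt maxm.
Qed.

End EulerCharacteristic.

Section BlockEuler.
Local Open Scope ring_scope.
Variable (T : finType).
Implicit Types (D : {set {set T}}) (s t : {set T}) (bs : seq {set T}).

Definition union_of bs (m : {set 'I_(size bs)}) : {set T} :=
  \bigcup_(j in m) nth set0 bs j.

(** The alternating sum, over all subfamilies of [bs], of the indicators of
    their unions with [G]. *)
Fixpoint block_euler D bs G : int :=
  if bs is b :: bs' then block_euler D bs' G - block_euler D bs' (b :|: G)
  else (G \in D)%:R.

Lemma block_eulerE D bs :
  block_euler D bs set0 =
  \sum_(m : {set 'I_(size bs)} | union_of m \in D) (-1) ^+ #|m|.
Proof.
have gen (js : seq 'I_(size bs)) (G : {set T}) : uniq js ->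
    \sum_(m : {set 'I_(size bs)} | m \subset [set j in js])
      (-1) ^+ #|m| * ((union_of m :|: G) \in D)%:R
    = block_euler D [seq nth set0 bs (j : 'I__) | j <- js] G.
  elim: js G => [|j js IH] G /=.
    move=> _; rewrite (big_pred1 set0) => [|m]; last first.
      by rewrite set_nil subset0.
    by rewrite cards0 expr0 mul1r /union_of big_set0 set0U.
  case/andP=> jjs ujs; rewrite set_cons big_subset_setU1 ?inE // IH //.
  congr (_ + _); rewrite -IH // -sumrN; apply: eq_bigr => m mjs.
  have jm : j \notin m.
    by apply: contra jjs => /(subsetP mjs); rewrite inE.
  rewrite cardsU1 jm exprS mulN1r mulNr /union_of big_setU1 //=.
  by rewrite [X in X :|: G]setUC setUA.
have := gen (enum 'I_(size bs)) set0 (enum_uniq _).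
rewrite (_ : map _ _ = bs); last first.
  by rewrite (map_comp (nth set0 bs)) val_enum_ord map_nth_iota0 ?take_size.
move=> <-; rewrite [RHS]big_mkcond [LHS]big_mkcond /=; apply: eq_bigr => m _.
rewrite setU0 ifT; last by apply/subsetP => j _; rewrite inE mem_enum.
by case: ifP => _; rewrite ?mulr1 ?mulr0.
Qed.

Section Unions.
Variable bs : seq {set T}.
Hypotheses (bs0 : set0 \notin bs)
  (bs_disj : pairwise (fun s t => [disjoint s & t]) bs).

Let disj (i j : 'I_(size bs)) x :
  x \in nth set0 bs i -> x \in nth set0 bs j -> i = j.
Proof.
have ltc (a b : nat) : (a < b < size bs)%N -> x \in nth set0 bs a ->
    x \in nth set0 bs b = false.
  case/andP=> ab bb xa; apply: disjointFr xa.
  have /(pairwiseP set0) := bs_disj; apply=> //.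
  by rewrite inE (ltn_trans ab).
move=> xi xj; apply: val_inj; case: (ltngtP i j) => // l.
  by rewrite (ltc i j) ?l ?ltn_ord in xj.
by rewrite (ltc j i) ?l ?ltn_ord in xi.
Qed.

Lemma union_of_sub (m m' : {set 'I_(size bs)}) :
  (union_of m \subset union_of m') = (m \subset m').
Proof.
apply/idP/idP => [|mm']; last first.
  by apply/bigcupsP => j jm; apply: bigcup_sup; apply: (subsetP mm').
move/subsetP => h; apply/subsetP => j jm.
have : nth set0 bs j != set0 by apply: contraNneq bs0 => <-; apply: mem_nth.
case/set0Pn => x xj; have /bigcupP[i im xi] : x \in union_of m'.
  by apply: h; apply/bigcupP; exists j.
by rewrite (disj xj xi).
Qed.

Lemma union_of_inj : injective (@union_of bs).
Proof.
move=> m m' e; apply/eqP; rewrite eqEsubset -!union_of_sub e subxx.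
by [].
Qed.

End Unions.

Definition invariant_faces D (gs : seq {perm T}) : {set {set T}} :=
  [set s in D :\ set0 | all (fun g : {perm T} => g @: s == s) gs].

Section EulerEquation.
Variables (D : {set {set T}}) (p : nat) (gs : seq {perm T}).
Hypotheses (D_ne : nonevasive D) (D_dc : down_closed D) (p_pr : prime p).
Hypotheses
  (gs_D : {in gs, forall (g : {perm T}) s, s \in D -> g @: s \in D})
  (gs_p : {in gs, forall g, (g ^+ p = 1)%g})
  (gs_comm : {in gs &, forall g h, commute g h}).

(** The elements of [gs] generate an elementary abelian [p]-group; the Smith
    theorem is applied to its generators one at a time, each acting on the faces
    invariant under the others by commutation. *)
Lemma invariant_faces_acyclic : acyclic (@ltp T) 'F_p (invariant_faces D gs).
Proof.
have p0 : p%:R = 0 :> 'F_p by apply/eqP; rewrite -(dvdn_pcharf (pchar_Fp p_pr)).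
elim: gs gs_D gs_p gs_comm => [|g hs IH] inD gp comm.
  rewrite (_ : invariant_faces D [::] = D :\ set0).
    exact: nonevasive_acyclic.
  by apply/setP => s; rewrite inE andbT.
have ghs : g \in g :: hs by apply: mem_head.
have sub h : h \in hs -> h \in g :: hs by rewrite inE orbC => ->.
have g_inj : injective g := @perm_inj _ g.
rewrite (_ : invariant_faces D (g :: hs) =
  [set s in invariant_faces D hs | g @: s == s]); last first.
  by apply/setP => s; rewrite !inE /= [X in _ && X]andbC andbA.
apply: (smith (@ltp_irr T) (@ltp_trans T) p_pr p0 (g := fun s => g @: s)).
- exact: imset_inj.
- move=> s t; rewrite /ltp; apply/idP/idP.
    rewrite !properE => /andP[st ts]; apply/andP; split.
      apply/subsetP => x xs; have := subsetP st (g x) (imset_f g xs).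
      by rewrite mem_imset.
    by apply: contra ts; apply: imsetS.
  by apply: imset_proper => x y _ _; apply: g_inj.
- move=> s; rewrite !inE => /andP[/andP[s0 sD] /allP inv].
  rewrite inD // andbT imset_eq0 s0 /=; apply/allP => h hh.
  rewrite -imset_comp (eq_imset (g := g \o h)); last first.
    by move=> x; rewrite /= -!permM (comm g h ghs (sub h hh)).
  by rewrite imset_comp (eqP (inv h hh)).
- move=> s _; rewrite -[RHS]imset_id (_ : iter p _ s = [set iter p g x | x in s]).
    by apply: eq_imset => x; rewrite -permX gp // perm1.
  by elim: (p) => [|n IHn] /=; rewrite ?imset_id // IHn -imset_comp.
by apply: IH => [h /sub/inD//|h /sub/gp//|h k /sub hh /sub]; apply: comm.
Qed.

Variables (f : {set T} -> {set T}) (bs : seq {set T}).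
Hypotheses
  (f_faces : {in invariant_faces D gs, forall s, f s \in invariant_faces D gs})
  (f_mono : {in invariant_faces D gs &, forall s t, s \subset t -> f s \subset f t})
  (bs0 : set0 \notin bs)
  (bs_disj : pairwise (fun s t => [disjoint s & t]) bs)
  (bs_inv : {in gs, forall g : {perm T}, {in bs, forall b : {set T}, g @: b = b}})
  (bs_fix : forall m : {set 'I_(size bs)}, f (union_of m) = union_of m)
  (bs_all : forall s, s \in invariant_faces D gs -> f s = s ->
     exists m : {set 'I_(size bs)}, s = union_of m).

(** Each monotone self-map [f] of the invariant faces gives a linear equation
    between indicators, as soon as its fixed points are the faces that are unions
    of given blocks. *)
Theorem block_euler_eq0 : block_euler D bs set0 = 0.
Proof.
pose K := [set m : {set 'I_(size bs)} | union_of m \in D].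
have inv_union (g : {perm T}) (m : {set 'I_(size bs)}) :
  g \in gs -> g @: union_of m = union_of m.
  move=> gg; rewrite /union_of; apply/setP => x; apply/imsetP/bigcupP.
    case=> y /bigcupP[j jm yj] ->; exists j => //.
    by rewrite -(bs_inv gg (mem_nth set0 (ltn_ord j))) imset_f.
  case=> j jm; rewrite -{1}(bs_inv gg (mem_nth set0 (ltn_ord j))).
  by case/imsetP => y yj ->; exists y => //; apply/bigcupP; exists j.
have u0 : union_of (set0 : {set 'I_(size bs)}) = set0 by rewrite /union_of big_set0.
have D0 : set0 \in D.
  elim: D_ne => [v|D' v vD _ h _ _]; first by rewrite !inE eqxx.
  by move: h; rewrite inE => /andP[].
have fixE : [set s in invariant_faces D gs | f s == s] =
    (@union_of bs) @: (K :\ set0).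
  apply/setP => s; rewrite inE; apply/andP/imsetP.
    case=> sQ /eqP/(bs_all sQ)[m sE]; exists m => //.
    move: sQ; rewrite !inE sE => /andP[/andP[m0 mD] _]; rewrite mD andbT.
    by apply: contraNneq m0 => ->; rewrite u0.
  case=> m; rewrite !inE => /andP[m0 mD] ->; rewrite bs_fix eqxx mD andbT.
  split=> //; apply/andP; split; last by apply/allP => g gg; rewrite inv_union.
  by rewrite -u0 (inj_eq (union_of_inj bs0 bs_disj)).
have f_mono' : {in invariant_faces D gs &, forall s t,
    ltp s t -> (f s == f t) || ltp (f s) (f t)}.
  move=> s t sQ tQ /proper_sub st; have := f_mono sQ tQ st.
  by rewrite /ltp properEneq => ->; rewrite andbT orbN.
have := lefschetz (@ltp_irr T) (@ltp_trans T) f_faces f_mono' p_pr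
  invariant_faces_acyclic.
rewrite fixE -/(chain_sum _ _) chain_sum_faces.
- move=> e; rewrite block_eulerE; apply: etrans e.
  by apply: eq_bigl => m; rewrite inE.
- exact: union_of_inj.
- by move=> m m'; rewrite /ltp !properE !union_of_sub.
- by rewrite inE u0.
move=> m m' mm'; rewrite !inE; apply: D_dc.
by rewrite union_of_sub.
Qed.

End EulerEquation.
End BlockEuler.

(** * Graphs on ten vertices as relations on numbers *)

Section EdgesByNumbers.

Definition pairs : seq (nat * nat) :=
  [seq p <- [seq (x, y) | x <- iota 0 10, y <- iota 0 10] | p.1 < p.2].

Lemma mem_pairs x y : ((x, y) \in pairs) = (x < y < 10).
Proof.
rewrite mem_filter; apply: andb_id2l => xy.
apply/allpairsP/idP => [[q [_ + [_ ->]]]|y10]; first by rewrite mem_iota.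
by exists (x, y); rewrite !mem_iota (ltn_trans xy y10).
Qed.

(* A default value for [insubd]. *)
Definition edge0 : edge :=
  exist _ [set ord0; ord_max] (introT eqP (cards2 ord0 ord_max)).

Definition ed (x y : nat) : edge := insubd edge0 [set inord x; inord y].

Lemma inord_eq (m n : nat) : m < 10 -> n < 10 ->
  (inord m == inord n :> vertex) = (m == n).
Proof. by move=> m10 n10; rewrite -val_eqE /= !inordK. Qed.

Lemma val_ed x y : x < 10 -> y < 10 -> x != y ->
  val (ed x y) = [set inord x; inord y].
Proof.
move=> x10 y10 xy; rewrite val_insubd cards2 inord_eq //.
by rewrite xy.
Qed.

Lemma edC x y : ed x y = ed y x.
Proof. by rewrite /ed setUC. Qed.

Lemma set2_inord (a b c d : nat) : a < 10 -> b < 10 -> c < 10 -> d < 10 ->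
  ([set inord a; inord b] == [set inord c; inord d] :> {set vertex}) =
  ((a == c) && (b == d)) || ((a == d) && (b == c)).
Proof.
move=> a10 b10 c10 d10.
apply/eqP/orP => [/setP e|[]/andP[/eqP-> /eqP->] //]; last exact: setUC.
have := e (inord a); have := e (inord b); have := e (inord c); have := e (inord d).
rewrite !inE !inord_eq // !eqxx /= orbT => ha hb hc hd.
by apply/orP; lia.
Qed.

Lemma edP (e : edge) : exists2 p, p \in pairs & e = ed p.1 p.2.
Proof.
have /cards2P[x [y [xy eE]]] := valP e.
have e_ed : e = ed x y.
  by apply: val_inj; rewrite val_ed ?ltn_ord // !inord_val.
case: (ltngtP x y) => [l|l|/val_inj exy]; last by rewrite exy eqxx in xy.
  by exists (val x, val y); rewrite // mem_pairs l ltn_ord.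
by exists (val y, val x); rewrite // ?mem_pairs ?l ?ltn_ord // edC.
Qed.

(** Only the values of [r] at pairs [x < y] matter, so that [r] need be neither
    symmetric nor irreflexive. *)
Definition graph_of (r : rel nat) : graph :=
  [set e | has (fun p => (e == ed p.1 p.2) && r p.1 p.2) pairs].

Lemma ed_graph_of r p : p \in pairs -> (ed p.1 p.2 \in graph_of r) = r p.1 p.2.
Proof.
move=> pp; rewrite inE; apply/hasP/idP => [[q qp /andP[/eqP e]]|rp]; last first.
  by exists p; rewrite // eqxx.
suff -> : p = q by [].
case: p q pp qp e => a b [c d]; rewrite !mem_pairs /= => /andP[ab b10].
case/andP=> cd d10; have a10 := ltn_trans ab b10; have c10 := ltn_trans cd d10.
move/(congr1 val)/eqP; rewrite !val_ed ?ltn_eqF // set2_inord //.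
case/orP=> /andP[/eqP ac /eqP bd]; first by rewrite ac bd.
by move: ab; rewrite ac bd ltnNge (ltnW cd).
Qed.

Lemma graph_of_pairs (G : graph) r :
  all (fun p => (ed p.1 p.2 \in G) == r p.1 p.2) pairs -> G = graph_of r.
Proof.
move/allP => h; apply/setP => e; have [p pp ->] := edP e.
by rewrite ed_graph_of // (eqP (h p pp)).
Qed.

Lemma graph_of0 : graph_of (fun _ _ => false) = set0.
Proof.
by apply/setP => e; rewrite !inE; apply/hasP => -[p _]; rewrite andbF.
Qed.

Lemma graph_ofU r r' :
  graph_of r :|: graph_of r' = graph_of (fun x y => r x y || r' x y).
Proof.
apply/setP => e; have [p pp ->] := edP e.
by rewrite inE !ed_graph_of.
Qed.

(** One-line notation: the list [f] sends [x] to its entry at [x]. *)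
Definition img (f : seq nat) (x : nat) : nat := nth 0 f x.

Definition nat_perm (f : seq nat) : bool := perm_eq f (iota 0 10).

Definition vperm (f : seq nat) : {perm vertex} :=
  insubd (perm_one vertex) [ffun x : vertex => inord (img f x) : vertex].

Lemma nat_perm_lt f x : nat_perm f -> x < 10 -> img f x < 10.
Proof.
move=> pf x10; have := perm_mem pf (img f x).
by rewrite mem_nth ?(perm_size pf) // mem_iota /= => /esym.
Qed.

Lemma img_inj f x y : nat_perm f -> x < 10 -> y < 10 ->
  img f x = img f y -> x = y.
Proof.
move=> pf x10 y10 fxy; apply/eqP; rewrite -(nth_uniq 0 (s := f)) ?(perm_size pf) //.
  exact/eqP.
by rewrite (perm_uniq pf) iota_uniq.
Qed.

Lemma vpermE f (x : vertex) : nat_perm f -> val (vperm f x) = img f x.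
Proof.
move=> pf; rewrite /vperm -pvalE val_insubd ifT.
  by rewrite ffunE /= inordK // nat_perm_lt.
apply/injectiveP => y z; rewrite !ffunE => /(congr1 val).
rewrite /= !inordK ?nat_perm_lt // => fyz; apply: val_inj.
exact: img_inj fyz.
Qed.

Lemma eact_card (s : {perm vertex}) (e : edge) : #|s @: val e| == 2.
Proof. by rewrite card_imset ?(valP e) //; apply: perm_inj. Qed.

Definition eact (s : {perm vertex}) (e : edge) : edge := exist _ (s @: val e) (eact_card s e).

Lemma eact_inj s : injective (eact s).
Proof.
move=> e e' /(congr1 val) /= h; apply: val_inj.
exact: imset_inj (@perm_inj _ s) _ _ h.
Qed.

Definition eperm s : {perm edge} := perm (@eact_inj s).

Lemma val_eperm s e : val (eperm s e) = s @: val e.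
Proof. by rewrite permE. Qed.

Lemma epermM s t : eperm (s * t)%g = (eperm s * eperm t)%g.
Proof.
apply/permP => e; apply: val_inj; rewrite permM !val_eperm -imset_comp.
by apply: eq_imset => x; rewrite permM.
Qed.

Lemma eperm1 : eperm 1%g = 1%g.
Proof.
apply/permP => e; apply: val_inj; rewrite val_eperm perm1 -[RHS]imset_id.
by apply: eq_imset => x; rewrite perm1.
Qed.

Lemma eperm_ed f p : nat_perm f -> p \in pairs ->
  eperm (vperm f) (ed p.1 p.2) = ed (img f p.1) (img f p.2).
Proof.
case: p => x y pf; rewrite mem_pairs /= => /andP[xy y10].
have x10 := ltn_trans xy y10; apply: val_inj.
have fE (z : nat) : z < 10 -> vperm f (inord z) = inord (img f z).
  by move=> z10; apply: val_inj; rewrite vpermE //= !inordK ?nat_perm_lt.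
have fxy : img f x != img f y.
  by apply/eqP => /(img_inj pf x10 y10) e; rewrite e ltnn in xy.
rewrite val_eperm (val_ed x10 y10) ?ltn_eqF // val_ed ?nat_perm_lt //.
by rewrite imsetU1 imset_set1 !fE.
Qed.

End EdgesByNumbers.

Section Symmetrized.
Implicit Types (r b : rel nat) (f g h : seq nat).

Definition sym r : rel nat := fun x y => if x < y then r x y else r y x.

Lemma ed_sym r x y : x < 10 -> y < 10 -> x != y ->
  (ed x y \in graph_of r) = sym r x y.
Proof.
rewrite /sym => x10 y10; case: ltngtP => // l _.
  by rewrite (@ed_graph_of r (x, y)) ?mem_pairs ?l.
by rewrite edC (@ed_graph_of r (y, x)) ?mem_pairs ?l.
Qed.

Lemma pairs_lt p : p \in pairs -> [/\ p.1 < 10, p.2 < 10 & p.1 != p.2].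
Proof.
case: p => x y; rewrite mem_pairs /= => /andP[xy y10].
by split=> //; [apply: ltn_trans xy y10|rewrite ltn_eqF].
Qed.

Lemma nat_perm_neq f x y : nat_perm f -> x < 10 -> y < 10 -> x != y ->
  img f x != img f y.
Proof. by move=> pf x10 y10; apply: contraNneq => /(img_inj pf x10 y10)->. Qed.

Definition maps_into f r r' : bool :=
  all (fun p => r p.1 p.2 ==> sym r' (img f p.1) (img f p.2)) pairs.

Lemma maps_intoP f r r' : nat_perm f -> maps_into f r r' ->
  eperm (vperm f) @: graph_of r \subset graph_of r'.
Proof.
move=> pf /allP h; apply/subsetP => _ /imsetP[e er ->].
have [p pp eE] := edP e; rewrite eE ed_graph_of // in er.
rewrite eE eperm_ed //; have [x10 y10 xy] := pairs_lt pp.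
rewrite ed_sym ?nat_perm_lt ?nat_perm_neq //.
by have := h p pp; rewrite er.
Qed.

Lemma maps_into_fix f r : nat_perm f -> maps_into f r r ->
  eperm (vperm f) @: graph_of r = graph_of r.
Proof.
move=> pf fr; apply/eqP; rewrite eqEcard maps_intoP //= card_imset //.
exact: perm_inj.
Qed.

Lemma vperm_comp f g : nat_perm f -> nat_perm g -> forall x : vertex,
  val ((vperm f * vperm g)%g x) = img g (img f x).
Proof. by move=> pf pg x; rewrite permM !vpermE. Qed.

Lemma epermX s n : eperm (s ^+ n)%g = (eperm s ^+ n)%g.
Proof.
by elim: n => [|n IH]; rewrite ?expg0 ?eperm1 // !expgS epermM IH.
Qed.

Lemma vpermX f p : nat_perm f -> all (fun x => iter p (img f) x == x) (iota 0 10) ->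
  (eperm (vperm f) ^+ p = 1)%g.
Proof.
move=> pf /allP h; rewrite -epermX -eperm1; congr eperm.
apply/permP => x; apply: val_inj; rewrite perm1 permX.
have -> : val (iter p (vperm f) x) = iter p (img f) x.
  by elim: p {h} => //= n <-; rewrite vpermE.
by apply/eqP/h; rewrite mem_iota ltn_ord.
Qed.

Lemma vpermM_eq f g f' g' : nat_perm f -> nat_perm g -> nat_perm f' ->
  nat_perm g' -> all (fun x => img f (img g x) == img f' (img g' x)) (iota 0 10) ->
  (eperm (vperm g) * eperm (vperm f) = eperm (vperm g') * eperm (vperm f'))%g.
Proof.
move=> pf pg pf' pg' /allP h; rewrite -!epermM; congr eperm.
apply/permP => x; apply: val_inj; rewrite !vperm_comp //.
by apply/eqP/h; rewrite mem_iota ltn_ord.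
Qed.

Definition sort_pair (p : nat * nat) := if p.1 < p.2 then p else (p.2, p.1).

Definition grow (gens : seq (seq nat)) (l : seq (nat * nat)) :=
  undup (l ++
    flatten [seq [seq sort_pair (img g q.1, img g q.2) | q <- l] | g <- gens]).

(** Ten rounds of closure are enough for the groups used below, whose orbits
    are exhausted by short words; soundness does not depend on this number. *)
Definition edge_orbit gens p := iter 10 (grow gens) [:: p].

Definition fixes (gens : seq (seq nat)) (s : graph) : bool :=
  all (fun g => eperm (vperm g) @: s == s) gens.

Lemma imset_perm_in (g : {perm edge}) (s : graph) x :
  g @: s = s -> (g x \in s) = (x \in s).
Proof. by move=> gs; rewrite -{1}gs mem_imset //; apply: perm_inj. Qed.

Lemma ed_sort_pair x y : ed (sort_pair (x, y)).1 (sort_pair (x, y)).2 = ed x y.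
Proof. by rewrite /sort_pair /=; case: ifP => //=; rewrite edC. Qed.

Lemma edge_orbitP gens p s : all nat_perm gens -> fixes gens s -> p \in pairs ->
  {in edge_orbit gens p, forall q, (q \in pairs) &&
     ((ed q.1 q.2 \in s) == (ed p.1 p.2 \in s))}.
Proof.
move=> /allP pg /allP fg pp; rewrite /edge_orbit.
suff: forall n, {in iter n (grow gens) [:: p], forall q, (q \in pairs) &&
     ((ed q.1 q.2 \in s) == (ed p.1 p.2 \in s))} by apply.
elim=> [|n IH] q; first by rewrite inE => /eqP ->; rewrite pp eqxx.
rewrite iterS; set l := iter _ _ _ in IH *; rewrite mem_undup mem_cat.
case/orP => [/IH//|/flattenP[l' /mapP[g gg ->] /mapP[q' /IH/andP[q'p /eqP q's] ->]]].
have fgg : eperm (vperm g) @: s = s by apply/eqP/fg.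
rewrite ed_sort_pair -eperm_ed ?pg // (imset_perm_in _ fgg).
rewrite q's eqxx andbT; have [x10 y10 xy] := pairs_lt q'p.
have := nat_perm_neq (pg g gg) x10 y10 xy; rewrite /sort_pair /=.
by case: ltngtP => // l1 _; rewrite mem_pairs l1 nat_perm_lt ?pg.
Qed.

Definition one_orbit gens b : bool :=
  let l := [seq p <- pairs | b p.1 p.2] in
  if l is p :: _ then all (mem (edge_orbit gens p)) l else false.

Lemma one_orbitP gens b s : all nat_perm gens -> fixes gens s ->
  one_orbit gens b -> (graph_of b \subset s) || [disjoint graph_of b & s].
Proof.
rewrite /one_orbit => pg fg; case l: [seq _ <- _ | _] => [//|p l'] /allP h.
have mem_l q : q \in pairs -> b q.1 q.2 -> q \in p :: l'.
  by move=> qp bq; rewrite -l mem_filter bq.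
have pp : p \in pairs.
  by have := mem_head p l'; rewrite -l mem_filter => /andP[].
have orb q : q \in pairs -> b q.1 q.2 -> (ed q.1 q.2 \in s) = (ed p.1 p.2 \in s).
  move=> qp bq; have /andP[_ /eqP//] := edge_orbitP pg fg pp (h q (mem_l q qp bq)).
case: (boolP (ed p.1 p.2 \in s)) => ps; apply/orP; [left|right].
  apply/subsetP => e; have [q qp ->] := edP e; rewrite ed_graph_of // => bq.
  by rewrite orb.
rewrite disjoints_subset; apply/subsetP => e; have [q qp ->] := edP e.
by rewrite ed_graph_of // inE => bq; rewrite orb.
Qed.

End Symmetrized.

Lemma union_of_blocks (T : finType) (bs : seq {set T}) (s : {set T}) :
  {in bs, forall b : {set T}, (b \subset s) || [disjoint b & s]} ->
  {in s, forall x, has (fun b : {set T} => x \in b) bs} ->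
  exists m : {set 'I_(size bs)}, s = union_of m.
Proof.
move=> dich cov; exists [set j : 'I_(size bs) | nth set0 bs j \subset s].
apply/setP => x; apply/idP/bigcupP => [xs|[j]]; last first.
  by rewrite inE => /subsetP h /h.
have /hasP[b bbs xb] := cov x xs; have /(nthP set0)[i il bE] := bbs.
exists (Ordinal il) => /=; last by rewrite bE.
rewrite inE /= bE; have /orP[//|] := dich b bbs.
by move/disjointFr/(_ xb); rewrite xs.
Qed.

Section Property.
Variable D : {set graph}.
Hypotheses (D_iso : forall s (G : graph), G \in D -> eperm s @: G \in D)
  (D_dc : down_closed D) (D_ne : nonevasive D) (D_full : [set: edge] \notin D).
Implicit Types (r b : rel nat) (f g h : seq nat).

Definition graph_in r : bool := graph_of r \in D.

Lemma D_iso_inv (s : {perm vertex}) (G : graph) :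
  eperm s @: G \in D -> G \in D.
Proof.
move/(D_iso s^-1%g); rewrite -imset_comp (eq_imset (g := id)) ?imset_id // => e.
by rewrite /= -permM -epermM mulgV eperm1 perm1.
Qed.

Lemma graph_in_maps f r r' : nat_perm f -> maps_into f r r' ->
  graph_in r' -> graph_in r.
Proof.
move=> pf frr' r'D; apply: (@D_iso_inv (vperm f)).
by apply: D_dc r'D; apply: maps_intoP.
Qed.

Definition degree (a : rel nat) x := count (a x) (iota 0 10).

Definition next_vertex (a : rel nat) (l : seq nat) :=
  foldr (fun x y => if x \in l then y else if y \in l then x else
    if count (a y) l <= count (a x) l then x else y) (head 0 l) (iota 0 10).

(** Backtracking search for an embedding of the graph [a] in [a'], extending a
    partial map from [l] to [l'].  Vertices with many placed neighbours come first.
    Only the list it returns is checked, in [embeds]. *)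
Fixpoint extend_embedding (a a' : rel nat) n (l l' : seq nat) : seq (nat * nat) :=
  if n is n'.+1 then
    let x := next_vertex a l in
    (fix try cs := if cs is c :: cs' then
       if c \in l' then try cs' else
       if degree a' c < degree a x then try cs' else
       if all2 (fun y d => a x y ==> a' c d) l l' then
         if extend_embedding a a' n' (x :: l) (c :: l') is q :: s then q :: s
         else try cs'
       else try cs' else [::]) (iota 0 10)
  else zip l l'.

(** The adjacency matrix, computed once for all. *)
Definition tabulate (a : rel nat) : rel nat :=
  let rows := [seq [seq a x y | y <- iota 0 10] | x <- iota 0 10] in
  fun x y => nth false (nth [::] rows x) y.

Definition embeds r r' : bool :=
  let a := tabulate (sym r) in
  let a' := tabulate (sym r') in
  let s := extend_embedding a a' 10 [::] [::] in
  let f := [seq (nth (0, 0) s (index x (unzip1 s))).2 | x <- iota 0 10] in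
  if nat_perm f then maps_into f r r' else false.

Lemma graph_in_embeds r r' : embeds r r' -> graph_in r' -> graph_in r.
Proof.
by rewrite /embeds; case: ifP => // pf; apply: graph_in_maps.
Qed.

Lemma graph_in_iso r r' : embeds r r' && embeds r' r -> graph_in r = graph_in r'.
Proof.
by case/andP=> h h'; apply/idP/idP; apply: graph_in_embeds.
Qed.

Definition empty_rel : rel nat := fun _ _ => false.
Definition full_rel : rel nat := fun x y => x != y.
Definition rel_union r r' : rel nat := fun x y => r x y || r' x y.

Fixpoint euler (bs : seq (rel nat)) r : int :=
  if bs is b :: bs' then (euler bs' r - euler bs' (rel_union b r))%R
  else Posz (graph_in r).

Lemma block_euler_graph_of bs r :
  block_euler D [seq graph_of b | b <- bs] (graph_of r) = euler bs r.
Proof.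
elim: bs r => [|b bs IH] r /=; first by rewrite /graph_in natz.
by rewrite graph_ofU !IH.
Qed.

Section Equation.
Variables (p : nat) (gs : seq (seq nat)) (bs : seq (rel nat)).
Hypotheses (p_pr : prime p) (gs_perm : all nat_perm gs)
  (gs_p : all (fun g => all (fun x => iter p (img g) x == x) (iota 0 10)) gs)
  (gs_comm : all (fun g => all (fun h =>
     all (fun x => img g (img h x) == img h (img g x)) (iota 0 10)) gs) gs)
  (bs_ne : all (fun b => has (fun q => b q.1 q.2) pairs) bs)
  (bs_disj : pairwise (fun b c =>
     all (fun q => ~~ (b q.1 q.2 && c q.1 q.2)) pairs) bs)
  (bs_inv : all (fun g => all (fun b => maps_into g b b) bs) gs).

Definition edge_perms : seq {perm edge} := [seq eperm (vperm g) | g <- gs].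
Definition blocks : seq graph := [seq graph_of b | b <- bs].

Lemma mem_invariant_faces s : (s \in invariant_faces D edge_perms) =
  [&& s != set0, s \in D & fixes gs s].
Proof. by rewrite !inE all_map -andbA. Qed.

Lemma blocks_ne : set0 \notin blocks.
Proof.
have /allP h : all (fun G : graph => G != set0) blocks.
  rewrite all_map; apply: sub_all bs_ne => b /hasP[q qp bq].
  by apply/set0Pn; exists (ed q.1 q.2); rewrite ed_graph_of.
by apply/negP => /h; rewrite eqxx.
Qed.

Lemma blocks_disjoint : pairwise (fun s t : graph => [disjoint s & t]) blocks.
Proof.
rewrite pairwise_map; apply: sub_pairwise bs_disj => b c /allP h /=.
rewrite disjoints_subset; apply/subsetP => e; have [q qp ->] := edP e.
by rewrite in_setC !ed_graph_of // => bq; have := h q qp; rewrite bq.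
Qed.

Lemma block_euler_blocks (f : graph -> graph) :
  {in invariant_faces D edge_perms, forall s,
     f s \in invariant_faces D edge_perms} ->
  {in invariant_faces D edge_perms &, forall s t : graph,
     s \subset t -> f s \subset f t} ->
  (forall m : {set 'I_(size blocks)}, f (union_of m) = union_of m) ->
  (forall s, s \in invariant_faces D edge_perms -> f s = s ->
     exists m : {set 'I_(size blocks)}, s = union_of m) ->
  euler bs empty_rel = 0%R.
Proof.
move=> f_faces f_mono f_fix f_all.
rewrite -block_euler_graph_of graph_of0.
apply: (block_euler_eq0 D_ne D_dc p_pr _ _ _ f_faces f_mono) => //.
- by move=> _ /mapP[g gg ->] s; apply: D_iso.
- by move=> _ /mapP[g gg ->]; apply: vpermX; [apply: (allP gs_perm)|apply: (allP gs_p)].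
- move=> _ _ /mapP[g gg ->] /mapP[h hh ->]; apply: vpermM_eq;
    rewrite ?(allP gs_perm) //.
  by have /allP/(_ g gg) := allP gs_comm h hh.
- exact: blocks_ne.
- exact: blocks_disjoint.
move=> _ /mapP[g gg ->].
have : all (fun G : graph => eperm (vperm g) @: G == G) blocks.
  rewrite all_map; apply: sub_all (allP bs_inv g gg) => b gb /=.
  by apply/eqP/maps_into_fix => //; apply: (allP gs_perm).
by move=> /allP h b /h/eqP.
Qed.

Lemma union_of_orbits gens (s : graph) :
  all nat_perm gens -> fixes gens s -> all (one_orbit gens) bs ->
  all (fun q => (ed q.1 q.2 \in s) ==> has (fun b => b q.1 q.2) bs) pairs ->
  exists m : {set 'I_(size blocks)}, s = union_of m.
Proof.
move=> pg fg orb /allP cov; apply: union_of_blocks.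
  have : all (fun b : graph => (b \subset s) || [disjoint b & s]) blocks.
    by rewrite all_map; apply: sub_all orb => b; apply: one_orbitP.
  by move/allP.
move=> e; have [q qp ->] := edP e => qs; have := cov q qp; rewrite qs has_map /=.
by apply: sub_has => b /=; rewrite ed_graph_of.
Qed.

(** The instance where [f] is the action of a permutation normalizing the group
    generated by [gs]: the fixed points of [f] are then the graphs invariant under
    [r] and [gs], that is the unions of orbits of edges. *)
Lemma euler_of_rotation (r : seq nat) :
  nat_perm r ->
  all (fun g => has (fun h =>
     all (fun x => img g (img r x) == img r (img h x)) (iota 0 10)) gs) gs ->
  all (fun b => maps_into r b b) bs -> all (one_orbit (r :: gs)) bs ->
  all (fun q => has (fun b => b q.1 q.2) bs) pairs ->
  euler bs empty_rel = 0%R.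
Proof.
move=> pr conj rb orb cov; pose f := fun s : graph => eperm (vperm r) @: s.
have rblock : {in blocks, forall b : graph, f b = b}.
  have : all (fun G : graph => f G == G) blocks.
    rewrite all_map; apply: sub_all rb => b gb /=.
    by apply/eqP/maps_into_fix.
  by move=> /allP h b /h/eqP.
apply: (@block_euler_blocks f).
- move=> s; rewrite !mem_invariant_faces => /and3P[s0 sD /allP fs].
  rewrite imset_eq0 s0 D_iso //=; apply/allP => g gg.
  have /hasP[h hh e] := allP conj g gg.
  have perm := allP gs_perm.
  have eE := vpermM_eq (perm g gg) pr pr (perm h hh) e.
  apply/eqP; rewrite /f -{2}(eqP (fs h hh)) -!imset_comp; apply: eq_imset => x /=.
  by rewrite -!permM eE.
- by move=> s t _ _ st; apply: imsetS.
- move=> m; rewrite /union_of /f; apply/setP => x; apply/imsetP/bigcupP.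
    case=> y /bigcupP[j jm yj] ->; exists j => //.
    by rewrite -(rblock _ (mem_nth set0 (ltn_ord j))) imset_f.
  case=> j jm; rewrite -{1}(rblock _ (mem_nth set0 (ltn_ord j))).
  by case/imsetP => y yj ->; exists y => //; apply/bigcupP; exists j.
move=> s; rewrite mem_invariant_faces => /and3P[_ _ fs] rs.
apply: (@union_of_orbits (r :: gs)) => //.
- by rewrite /= pr.
- by apply/andP; split; first exact/eqP.
by apply: sub_all cov => q ->; rewrite implybT.
Qed.

End Equation.
End Property.

(** * The retraction onto two five-vertex halves and a matching *)

Definition circ_rel (Ds : seq nat) : rel nat :=
  fun x y => (y - x \in Ds) || (10 + x - y \in Ds).

Definition petersen_rel : rel nat := fun x y =>
  if y < 5 then (x.+1 %% 5 == y) || (y.+1 %% 5 == x)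
  else if x < 5 then x + 5 == y
  else (((x - 5).+2 %% 5) + 5 == y) || (((y - 5).+2 %% 5) + 5 == x).

Definition within (b : bool) (Ds : seq nat) : rel nat :=
  fun x y => [&& odd x == b, odd y == b & circ_rel Ds x y].

Definition matching := circ_rel [:: 5].
Definition same_parity : rel nat := fun x y => odd x == odd y.
Definition cross_parity : rel nat := fun x y => odd x != odd y.

Definition rotation k := mkseq (fun x => (x + k) %% 10) 10.

Section Fold.
Variable D : {set graph}.
Hypotheses (D_iso : forall s (G : graph), G \in D -> eperm s @: G \in D)
  (D_dc : down_closed D) (D_ne : nonevasive D).

(** On graphs invariant under the rotation by two, keep the edges inside each
    parity class and replace the edges between the classes, if any, by the
    single matching of antipodal pairs. *)
Definition fold (s : graph) : graph :=
  (s :&: graph_of same_parity) :|: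
  (if s :&: graph_of cross_parity == set0 then set0 else graph_of matching).

(** Rotates the odd vertices only, for odd [k].  It fixes every rotation-invariant set of
    edges inside the classes, and sends the antipodal matching to the matching of
    the edges [x], [x + k] with [x] even. *)
Definition odd_shift k :=
  mkseq (fun x => if odd x then (x + k + 5) %% 10 else x) 10.

Lemma mem_cross q : q \in pairs ->
  (ed q.1 q.2 \in graph_of cross_parity) = (ed q.1 q.2 \notin graph_of same_parity).
Proof. by move=> qp; rewrite !ed_graph_of. Qed.

Lemma foldS (s t : graph) : s \subset t -> fold s \subset fold t.
Proof.
move=> st; apply: setUSS; first exact: setSI.
case: ifP => // sc; first exact: sub0set.
case: ifP => // /eqP tc; case/eqP: sc; apply/eqP.
by rewrite -subset0 -tc setSI.
Qed.

Definition odd_numbers := [:: 1; 3; 5; 7; 9].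

Lemma rotation_perm : all nat_perm [:: rotation 2].
Proof. by vm_compute. Qed.

Lemma cross_orbits : all (fun q => cross_parity q.1 q.2 ==>
  has (fun k => q \in edge_orbit [:: rotation 2] (0, k)) odd_numbers) pairs.
Proof. by vm_compute. Qed.

Lemma odd_pairs : all (fun k => (0, k) \in pairs) odd_numbers.
Proof. by vm_compute. Qed.

Lemma odd_shift_perm : all (fun k => nat_perm (odd_shift k)) odd_numbers.
Proof. by vm_compute. Qed.

Definition shift_pair k (q : nat * nat) :=
  sort_pair (img (odd_shift k) q.1, img (odd_shift k) q.2).

Lemma shift_same_parity : all (fun k => all (fun q => same_parity q.1 q.2 ==>
  (shift_pair k q \in edge_orbit [:: rotation 2] q)) pairs) odd_numbers.
Proof. by vm_compute. Qed.

Lemma shift_matching : all (fun k => all (fun q => matching q.1 q.2 ==>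
  (shift_pair k q \in edge_orbit [:: rotation 2] (0, k))) pairs) odd_numbers.
Proof. by vm_compute. Qed.

(** An edge between the classes brings the whole matching of difference [k] with
    it, and [odd_shift k] then embeds the folded graph in the given one. *)
Lemma fold_in s : s \in D -> fixes [:: rotation 2] s -> fold s \in D.
Proof.
move=> sD fs; rewrite /fold; case: ifP => [_|/negbT].
  by rewrite setU0; apply: D_dc sD; apply: subsetIl.
case/set0Pn => e; rewrite in_setI; have [q qp ->] := edP e.
rewrite ed_graph_of // => /andP[qs qc].
have /hasP[k kD qk] := implyP (allP cross_orbits q qp) qc.
have kp := allP odd_pairs k kD.
have ks : ed (0, k).1 (0, k).2 \in s.
  by have /andP[_ /eqP <-] := edge_orbitP rotation_perm fs kp qk.
have shift_perm := allP odd_shift_perm k kD.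
apply: (@D_iso_inv _ D_iso (vperm (odd_shift k))); apply: D_dc sD.
apply/subsetP => _ /imsetP[e' + ->]; have [t tp ->] := edP e'.
rewrite eperm_ed // -[ed (img _ _) _]ed_sort_pair -/(shift_pair k t).
rewrite in_setU in_setI !ed_graph_of //.
case/orP => [/andP[ts st]|mt].
  have same := implyP (allP (allP shift_same_parity k kD) t tp) st.
  have /andP[_ /eqP orbE] := edge_orbitP rotation_perm fs tp same.
  by rewrite orbE.
have mat := implyP (allP (allP shift_matching k kD) t tp) mt.
have /andP[_ /eqP orbE] := edge_orbitP rotation_perm fs kp mat.
by rewrite orbE.
Qed.

Definition fold_blocks : seq (rel nat) :=
  [:: within false [:: 2]; within false [:: 4]; within true [:: 2];
      within true [:: 4]; matching].

(** The fold is a monotone retraction of the graphs invariant under the rotation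
    by two, and the graphs that it fixes are the unions of the five blocks. *)
Lemma euler_of_fold : euler D fold_blocks empty_rel = 0%R.
Proof.
have rot_perm : nat_perm (rotation 2) by vm_compute.
have not_cross (s : graph) : s :&: graph_of cross_parity = set0 ->
    s :&: graph_of same_parity = s.
  move=> sc; apply/setIidPl/subsetP => e; have [q qp ->] := edP e => qs.
  have := in_set0 (ed q.1 q.2); rewrite -sc in_setI qs /= mem_cross //.
  by move/negbFE.
have gs_p : all (fun g => all (fun x => iter 5 (img g) x == x) (iota 0 10))
  [:: rotation 2] by vm_compute.
have gs_comm : all (fun g => all (fun h => all (fun x =>
  img g (img h x) == img h (img g x)) (iota 0 10)) [:: rotation 2])
  [:: rotation 2] by vm_compute.
have bs_ne : all (fun b => has (fun q => b q.1 q.2) pairs) fold_blocks.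
  by vm_compute.
have bs_disj : pairwise (fun b c =>
  all (fun q => ~~ (b q.1 q.2 && c q.1 q.2)) pairs) fold_blocks by vm_compute.
have bs_inv : all (fun g => all (fun b => maps_into g b b) fold_blocks)
  [:: rotation 2] by vm_compute.
apply: (block_euler_blocks D_iso D_dc D_ne (isT : prime 5) rotation_perm gs_p
  gs_comm bs_ne bs_disj bs_inv (f := fold)).
- move=> s; rewrite !mem_invariant_faces => /and3P[s0 sD fs].
  rewrite fold_in //; apply/andP; split=> /=.
    rewrite /fold; case: ifP => [/eqP sc|_].
      by rewrite setU0 not_cross.
    apply/set0Pn; exists (ed 0 5); rewrite in_setU (@ed_graph_of _ (0, 5)) //.
    by rewrite orbT.
  move: fs; rewrite /fixes /= !andbT => /eqP fs; apply/eqP.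
  have inj := @perm_inj _ (eperm (vperm (rotation 2))).
  rewrite /fold imsetU imsetI; last by move=> x y _ _; apply: inj.
  rewrite fs maps_into_fix //; congr (_ :|: _); case: ifP => _.
    by rewrite imset0.
  by rewrite maps_into_fix.
- by move=> s t _ _; apply: foldS.
- move=> m; have blockP : {in blocks fold_blocks, forall b : graph,
      b \subset graph_of same_parity \/ b = graph_of matching}.
    have sub r : all (fun q => r q.1 q.2 ==> same_parity q.1 q.2) pairs ->
        graph_of r \subset graph_of same_parity.
      move/allP => h; apply/subsetP => e; have [q qp ->] := edP e.
      by rewrite !ed_graph_of //; apply/implyP/h.
    by move=> b; rewrite !inE => /or4P[/eqP->|/eqP->|/eqP->|/orP[]/eqP->];
      [left|left|left|left|right]; rewrite ?sub.
  have memU (x : edge) : x \in union_of m ->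
      x \in graph_of same_parity \/ (x \in graph_of matching /\
        graph_of matching \subset union_of m).
    case/bigcupP => j jm xj.
    have [/subsetP h|bE] := blockP _ (mem_nth set0 (ltn_ord j)).
      by left; apply: h.
    right; rewrite -bE; split=> //; exact: bigcup_sup.
  rewrite /fold; case: ifP => [/eqP/not_cross->|/negbT]; first by rewrite setU0.
  case/set0Pn => e; rewrite in_setI => /andP[/memU eU ec].
  have [q qp eE] := edP e; rewrite eE mem_cross // in ec.
  case: eU => [es|[_ matU]]; first by rewrite -eE es in ec.
  apply/eqP; rewrite eqEsubset subUset subsetIl matU /=.
  apply/subsetP => x xU; rewrite in_setU in_setI xU /=.
  by apply/orP; case: (memU x xU) => [xs|[xm _]]; [left|right].
move=> s; rewrite mem_invariant_faces => /and3P[_ _ fs] fold_s.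
apply: (union_of_orbits rotation_perm fs); first by vm_compute.
apply/allP => q qp; apply/implyP; rewrite -{1}fold_s in_setU in_setI.
rewrite (fun_if (fun S : graph => ed q.1 q.2 \in S)) in_set0 !ed_graph_of // => h.
have : all (fun q => same_parity q.1 q.2 || matching q.1 q.2 ==>
   has (fun b => b q.1 q.2) fold_blocks) pairs by vm_compute.
move/allP/(_ q qp)/implyP; apply.
move: h; case: ifP => _; first by rewrite orbF => /andP[_ ->].
by case/orP => [/andP[_ ->] //|->]; rewrite orbT.
Qed.

End Fold.

(** * The graphs of the table *)

Definition compl_petersen_rel : rel nat := fun x y => ~~ petersen_rel x y.

Lemma circE Ds : circ Ds = graph_of (circ_rel Ds).
Proof.
apply: graph_of_pairs; apply/allP => q qp; have [x10 y10 xy] := pairs_lt qp.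
have xy' : q.1 < q.2 by move: qp; rewrite mem_filter => /andP[].
rewrite inE; apply/eqP; apply/existsP/idP => [[i /existsP[j /and3P[ji qE r]]]|r].
  have {qE} : [set inord q.1; inord q.2] == [set inord (val i); inord (val j)]
    :> {set vertex} by rewrite -val_ed // !inord_val.
  rewrite set2_inord ?ltn_ord // => qE.
  have [-> ->] : q.2 = val i /\ q.1 = val j.
    by move: qE ji xy' => /=; move: (nat_of_ord i) (nat_of_ord j) => a b; lia.
  exact: r.
exists (inord q.2); apply/existsP; exists (inord q.1).
by rewrite !inordK // xy' val_ed // setUC eqxx.
Qed.

Definition joins (q : nat * nat) a b :=
  ((q.1 == a) && (q.2 == b)) || ((q.1 == b) && (q.2 == a)).

Lemma petersenE : petersen = graph_of petersen_rel.
Proof.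
apply: graph_of_pairs; apply/allP => q qp; have [x10 y10 xy] := pairs_lt qp.
have -> : (ed q.1 q.2 \in petersen) = has (fun i =>
    [|| joins q i (i.+1 %% 5), joins q i (5 + i) | joins q (5 + i) (5 + i.+2 %% 5)])
    (iota 0 5).
  have edges (i : nat) : i < 5 -> [|| val (ed q.1 q.2) == [set inord i; inord (i.+1 %% 5)],
      val (ed q.1 q.2) == [set inord i; inord (5 + i)]
      | val (ed q.1 q.2) == [set inord (5 + i); inord (5 + i.+2 %% 5)]] =
      [|| joins q i (i.+1 %% 5), joins q i (5 + i) | joins q (5 + i) (5 + i.+2 %% 5)].
    move=> i5; have lt5 n : n %% 5 < 5 by rewrite ltn_mod.
    have i10 : i < 10 by apply: leq_trans i5 _.
    have m10 n : n %% 5 < 10 by apply: leq_trans (lt5 n) _.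
    have a10 n : n < 5 -> 5 + n < 10 by rewrite -(ltn_add2l 5).
    by rewrite val_ed // !set2_inord ?a10.
  rewrite inE; apply/existsP/hasP => [[i]|[i]].
    by rewrite edges // => h; exists (val i); rewrite // mem_iota ltn_ord.
  rewrite mem_iota add0n => /andP[_ i5] h; exists (Ordinal i5).
  by rewrite edges.
have : all (fun q => has (fun i =>
    [|| joins q i (i.+1 %% 5), joins q i (5 + i)
      | joins q (5 + i) (5 + i.+2 %% 5)]) (iota 0 5) == petersen_rel q.1 q.2)
  pairs by vm_compute.
by move/allP/(_ q qp).
Qed.

Lemma compl_petersenE : ~: petersen = graph_of compl_petersen_rel.
Proof.
apply: graph_of_pairs; apply/allP => q qp.
by rewrite in_setC petersenE ed_graph_of.
Qed.

(** * Recognizing graphs up to isomorphism *)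

Definition five_cycle := within false [:: 2].
Definition five_clique := within false [:: 2; 4].
Definition cycle_clique := rel_union five_cycle (within true [:: 2; 4]).

(** Representatives of the isomorphism classes that occur in the four
    equations. *)
Definition references : seq (rel nat) :=
  [:: empty_rel; full_rel; circ_rel [:: 1]; circ_rel [:: 2]; circ_rel [:: 5];
      circ_rel [:: 1; 2]; circ_rel [:: 1; 3]; circ_rel [:: 1; 4];
      circ_rel [:: 1; 5]; circ_rel [:: 2; 4]; circ_rel [:: 2; 5];
      circ_rel [:: 1; 2; 3]; circ_rel [:: 1; 2; 4]; circ_rel [:: 1; 2; 5];
      circ_rel [:: 1; 3; 5]; circ_rel [:: 1; 4; 5]; circ_rel [:: 2; 4; 5];
      circ_rel [:: 1; 2; 3; 4]; circ_rel [:: 1; 2; 3; 5];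
      circ_rel [:: 1; 2; 4; 5]; petersen_rel; compl_petersen_rel;
      five_cycle; five_clique; cycle_clique; rel_union five_cycle matching;
      rel_union five_clique matching; rel_union cycle_clique matching].

(** An isomorphism invariant, used only to avoid unsuccessful searches: for all
    pairs of vertices, adjacency and number of common neighbours. *)
Definition profile r : seq nat :=
  let a := tabulate (sym r) in
  sort leq [seq (if a q.1 q.2 then 10 else 0) +
    count (fun z => if a q.1 z then a q.2 z else false) (iota 0 10) | q <- pairs].

Definition reference_profiles : seq (seq nat) :=
  Eval vm_compute in [seq profile r | r <- references].

Definition matches (d : seq nat) r (pr : seq nat * rel nat) : bool :=
  if pr.1 == d then if embeds r pr.2 then embeds pr.2 r else false else false.

Definition classify r : nat :=
  find (matches (profile r) r) (zip reference_profiles references).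

Arguments classify r : simpl never.

(** The expansion of [euler] as a list of signs and of indices in
    [references]. *)
Fixpoint euler_terms (bs : seq (rel nat)) r : seq (bool * nat) :=
  if bs is b :: bs' then
    euler_terms bs' r ++
    [seq (~~ t.1, t.2) | t <- euler_terms bs' (rel_union b r)]
  else [:: (true, classify r)].

Section Classification.
Variable D : {set graph}.
Hypotheses (D_iso : forall s (G : graph), G \in D -> eperm s @: G \in D)
  (D_dc : down_closed D).

Lemma matchesP d r pr : matches d r pr -> graph_in D r = graph_in D pr.2.
Proof.
rewrite /matches; case: ifP => // _; case: ifP => // h h'.
by apply: graph_in_iso; rewrite ?h.
Qed.

Lemma classifyP r : classify r < size references ->
  graph_in D r = graph_in D (nth empty_rel references (classify r)).
Proof.
have sz : size reference_profiles = size references by [].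
move=> lt; have : has (matches (profile r) r) (zip reference_profiles references).
  by rewrite has_find size_zip sz minnn.
by move/(nth_find ([::], empty_rel))/matchesP; rewrite nth_zip.
Qed.

Definition eval_terms (v : nat -> nat) (ts : seq (bool * nat)) : int :=
  foldr (fun t z => if t.1 then (Posz (v t.2) + z)%R else (z - Posz (v t.2))%R)
    0%R ts.

Lemma eval_terms_cat v ts ts' :
  eval_terms v (ts ++ ts') = (eval_terms v ts + eval_terms v ts')%R.
Proof.
elim: ts => [|t ts IH] /=; first by rewrite add0r.
by rewrite IH; case: ifP => _; rewrite ?addrA // addrAC.
Qed.

Lemma eval_terms_opp v ts :
  eval_terms v [seq (~~ t.1, t.2) | t <- ts] = (- eval_terms v ts)%R.
Proof.
elim: ts => [|t ts IH] /=; first by rewrite oppr0.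
by rewrite IH; case: (t.1); rewrite /= ?opprB // opprD addrC.
Qed.

Let value k : nat := graph_in D (nth empty_rel references k).

Lemma eulerE bs r :
  all (fun t => t.2 < size references) (euler_terms bs r) ->
  euler D bs r = eval_terms value (euler_terms bs r).
Proof.
elim: bs r => [|b bs IH] r.
  case/andP; rewrite -/(classify r < size references) => /classifyP rE _.
  apply: etrans (_ : Posz (value (classify r)) = _); first by rewrite /value -rE.
  exact/esym/addr0.
rewrite [euler_terms _ _]/= all_cat all_map => /andP[h h'].
by rewrite eval_terms_cat eval_terms_opp -!IH.
Qed.

(** The valuation [v] is kept abstract so that the sum can be unfolded by
    computation without evaluating membership of graphs in [D]. *)
Lemma eval_terms_eq0 bs ts : euler_terms bs empty_rel = ts ->
  all (fun t => t.2 < size references) ts -> euler D bs empty_rel = 0%R ->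
  exists2 v : nat -> nat, eval_terms v ts = 0%R &
    [seq v k | k <- iota 0 (size references)] =
    [seq nat_of_bool (graph_in D r) | r <- references].
Proof.
move=> <- h; rewrite eulerE // => e; exists value => //.
Qed.

End Classification.

(** * The four equations *)

Definition half_rotation b :=
  mkseq (fun x => if odd x == b then (x + 2) %% 10 else x) 10.

Definition antipodal_swap k :=
  mkseq (fun x => if x %% 5 == k then (x + 5) %% 10 else x) 10.

Section Equations.
Variable D : {set graph}.
Hypotheses (D_iso : forall s (G : graph), G \in D -> eperm s @: G \in D)
  (D_dc : down_closed D) (D_ne : nonevasive D) (D_full : [set: edge] \notin D).

Let c (Ds : seq nat) : nat := graph_in D (circ_rel Ds).

Lemma graph_in_full : graph_in D full_rel = false.
Proof.
apply/negbTE; rewrite /graph_in (_ : graph_of full_rel = [set: edge]) //.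
apply/setP => e; have [q qp ->] := edP e; rewrite ed_graph_of // in_setT.
by have [] := pairs_lt qp.
Qed.

Lemma graph_in_empty : graph_in D empty_rel.
Proof.
rewrite /graph_in graph_of0; elim: D_ne => [v|D' v vD _ h _ _].
  by rewrite !inE eqxx.
by move: h; rewrite inE => /andP[].
Qed.

(* Turns the vanishing of [euler D bs empty_rel] into the explicit equation. *)
Ltac solve_equation bs :=
  let ts := eval vm_compute in (euler_terms bs empty_rel) in
  let e := fresh in
  have e : euler_terms bs empty_rel = ts; [by vm_compute|
  case/(eval_terms_eq0 D_iso D_dc e isT) => v; rewrite /eval_terms; cbn [foldr fst snd];
  move=> {}e; cbn [map references]; case;
  rewrite graph_in_empty graph_in_full;
  repeat match goal with |- context [nat_of_bool (graph_in D ?r)] =>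
    let b := fresh "b" in generalize (nat_of_bool (graph_in D r)); intro b end;
  lia].

Definition cyclic_blocks := [seq circ_rel [:: d] | d <- [:: 1; 2; 3; 4; 5]].

(** The rotation acts alone: its orbits of edges are the five circulants of one
    difference. *)
Lemma euler_cyclic :
  2 * c [:: 1] + c [:: 5] + 2 * c [:: 2] + c [:: 1; 3; 5] + 2 * c [:: 1; 4; 5]
  + 2 * c [:: 1; 2; 3] + 2 * c [:: 1; 2; 5] + 2 * c [:: 1; 2; 4]
  + c [:: 2; 4; 5]
  = 1 + 2 * c [:: 1; 5] + c [:: 1; 3] + 2 * c [:: 1; 4] + 2 * c [:: 2; 5]
  + 2 * c [:: 1; 2] + 2 * c [:: 1; 2; 3; 5] + c [:: 2; 4]
  + 2 * c [:: 1; 2; 4; 5] + c [:: 1; 2; 3; 4].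
Proof.
have : euler D cyclic_blocks empty_rel = 0%R.
  by apply: (@euler_of_rotation D D_iso D_dc D_ne 2 [::] cyclic_blocks isT _ _ _ _ _ _
    (rotation 1)); vm_compute.
rewrite /c. solve_equation cyclic_blocks.
Qed.

Definition clique_blocks :=
  [:: circ_rel [:: 2]; circ_rel [:: 4]; circ_rel [:: 1; 3; 5]].

(** The group of order 25 rotating the two parity classes independently leaves
    five orbits, which the rotation by one merges into three. *)
Lemma euler_cliques :
  c [:: 1; 3; 5] + 2 * c [:: 2] = 1 + 2 * c [:: 1; 2; 3; 5] + c [:: 2; 4].
Proof.
have : euler D clique_blocks empty_rel = 0%R.
  by apply: (@euler_of_rotation D D_iso D_dc D_ne 5
    [:: half_rotation false; half_rotation true] clique_blocks isT _ _ _ _ _ _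
    (rotation 1)); vm_compute.
rewrite /c; solve_equation clique_blocks.
Qed.

Definition matching_blocks :=
  [:: circ_rel [:: 5]; circ_rel [:: 1; 4]; circ_rel [:: 2; 3]].

(** The group of order 32 generated by the five swaps of antipodal vertices,
    together with the rotation: the blocks are the antipodal matching and the
    blow-ups of the two pentagons on antipodal pairs. *)
Lemma euler_matching :
  c [:: 5] + 2 * c [:: 1; 4] = 1 + 2 * c [:: 1; 4; 5] + c [:: 1; 2; 3; 4].
Proof.
have : euler D matching_blocks empty_rel = 0%R.
  by apply: (@euler_of_rotation D D_iso D_dc D_ne 2
    [seq antipodal_swap k | k <- iota 0 5] matching_blocks isT _ _ _ _ _ _
    (rotation 1)); vm_compute.
rewrite /c; solve_equation matching_blocks.
Qed.

(** The equation of the fold.  Two pentagons of the same slope, joined by the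
    matching, form a prism; two pentagons of different slopes form the Petersen
    graph. *)
Lemma euler_pentagons :
  4 * graph_in D five_cycle + c [:: 5]
  + 2 * graph_in D (rel_union five_clique matching)
  + 4 * graph_in D cycle_clique + 2 * c [:: 2; 5] + 2 * graph_in D petersen_rel
  + c [:: 2; 4; 5]
  = 1 + 2 * graph_in D five_clique
  + 4 * graph_in D (rel_union five_cycle matching) + 4 * c [:: 2]
  + 4 * graph_in D (rel_union cycle_clique matching) + c [:: 2; 4].
Proof.
have := euler_of_fold D_iso D_dc D_ne.
rewrite /c; solve_equation fold_blocks.
Qed.

End Equations.

(** * Monotonicity and the final case analysis *)

Definition circulant_embeddings : seq (rel nat * rel nat) :=
  [seq (circ_rel p.1, circ_rel p.2) | p <-
    [:: ([:: 1; 5], [:: 1; 4; 5]); ([:: 1; 2], [:: 1; 4; 5]);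
        ([:: 2; 5], [:: 1; 4]); ([:: 1], [:: 2; 5]); ([:: 1; 5], [:: 1; 3]);
        ([:: 1; 4], [:: 1; 2; 5]); ([:: 1; 2; 5], [:: 1; 2; 3]);
        ([:: 1; 2; 3], [:: 1; 2; 3; 5]); ([:: 1; 4], [:: 1; 2; 4]);
        ([:: 2; 4; 5], [:: 1; 2; 4]); ([:: 1; 2; 3], [:: 1; 2; 4; 5]);
        ([:: 1; 2; 4], [:: 1; 2; 4; 5])]].

Definition petersen_embeddings : seq (rel nat * rel nat) :=
  [:: (circ_rel [:: 2], petersen_rel);
      (petersen_rel, circ_rel [:: 1; 2; 3]);
      (petersen_rel, compl_petersen_rel);
      (circ_rel [:: 1; 3], compl_petersen_rel);
      (compl_petersen_rel, circ_rel [:: 1; 2; 3; 5]);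
      (five_clique, rel_union five_clique matching);
      (rel_union five_cycle matching, petersen_rel);
      (petersen_rel, rel_union cycle_clique matching);
      (rel_union cycle_clique matching, circ_rel [:: 2; 4; 5])].

Lemma embeddingsP (D : {set graph}) (l : seq (rel nat * rel nat)) :
  (forall s (G : graph), G \in D -> eperm s @: G \in D) -> down_closed D ->
  all (fun r => embeds r.1 r.2) l ->
  all (fun b => b.2 ==> b.1) [seq (graph_in D r.1, graph_in D r.2) | r <- l].
Proof.
move=> iso dc emb; rewrite all_map; apply: sub_all emb => r e /=.
by apply/implyP; apply: graph_in_embeds iso dc _ _ e.
Qed.

Lemma circulant_embeddings_ok :
  all (fun r => embeds r.1 r.2) circulant_embeddings.
Proof. by vm_compute. Qed.

Lemma petersen_embeddings_ok :
  all (fun r => embeds r.1 r.2) petersen_embeddings.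
Proof. by vm_compute. Qed.

(** Written with [if] rather than [&&] so that evaluation stops at the first
    failure; likewise below, where each failed constraint cuts its branch. *)
Definition both (P : bool -> bool) : bool := if P false then P true else false.

Lemma bothP P : both P -> forall b, P b.
Proof. by rewrite /both; case: ifP => // Pf Pt []. Qed.

Lemma ifP_true (b X : bool) : (if b then X else true) -> b -> X.
Proof. by case: b. Qed.

Definition table_rows : seq (seq nat) :=
  [:: [:: 1; 1; 1; 1; 1; 1];
      [:: 0; 1; 1; 1; 1; 1];
      [:: 1; 1; 1; 1; 1; 1];
      [:: 0; 1; 1; 1; 0; 1];
      [:: 1; 1; 0; 0; 0; 0];
      [:: 0; 1; 0; 1; 0; 1];
      [:: 1; 1; 0; 1; 1; 1];
      [:: 0; 0; 1; 1; 1; 1];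
      [:: 0; 1; 1; 1; 1; 1];
      [:: 0; 1; 0; 0; 0; 0];
      [:: 0; 0; 0; 1; 0; 0];
      [:: 0; 1; 0; 0; 0; 1];
      [:: 1; 1; 0; 0; 0; 0];
      [:: 0; 1; 0; 1; 0; 1];
      [:: 0; 0; 1; 1; 1; 1];
      [:: 0; 0; 0; 0; 0; 0];
      [:: 0; 1; 0; 0; 0; 0];
      [:: 0; 0; 0; 0; 0; 0];
      [:: 0; 1; 1; 1; 1; 1];
      [:: 0; 1; 0; 0; 0; 0]].

Lemma table_rowsE : unzip2 table = table_rows.
Proof. by []. Qed.

(** The exhaustive search: [bC], [bK], [bCK] stand for a pentagon, a five-clique and
    a pentagon next to a five-clique, a final [M] adds the antipodal matching, and
    [bP'] is the complement of the Petersen graph. *)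
Lemma case_analysis :
  both (fun b5 => both (fun b14 => both (fun b145 => both (fun b1234 =>
  if b5 + 2 * b14 == 1 + 2 * b145 + b1234 then
  both (fun b135 => both (fun b2 => both (fun b1235 => both (fun b24 =>
  if b135 + 2 * b2 == 1 + 2 * b1235 + b24 then
  both (fun b15 => both (fun b12 => both (fun b25 => both (fun b1 =>
  both (fun b13 => both (fun b125 => both (fun b123 =>
  both (fun b245 => both (fun b124 => both (fun b1245 =>
  if all (fun b => b.2 ==> b.1)
       [:: (b15, b145); (b12, b145); (b25, b14); (b1, b25); (b15, b13);
           (b14, b125); (b125, b123); (b123, b1235); (b14, b124);
           (b245, b124); (b123, b1245); (b124, b1245)] then
  if 2 * b1 + b5 + 2 * b2 + b135 + 2 * b145 + 2 * b123 + 2 * b125 + 2 * b124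
     + b245 == 1 + 2 * b15 + b13 + 2 * b14 + 2 * b25 + 2 * b12 + 2 * b1235
     + b24 + 2 * b1245 + b1234 then
  both (fun bP => both (fun bP' =>
  both (fun bC => both (fun bK => both (fun bCK => both (fun bCM =>
  both (fun bKM => both (fun bCKM =>
  if all (fun b => b.2 ==> b.1)
       [:: (b2, bP); (bP, b123); (bP, bP'); (b13, bP'); (bP', b1235);
           (bK, bKM); (bCM, bP); (bP, bCKM); (bCKM, b245)] then
  if 4 * bC + b5 + 2 * bKM + 4 * bCK + 2 * b25 + 2 * bP + b245
     == 1 + 2 * bK + 4 * bCM + 4 * b2 + 4 * bCKM + b24 then
  has (fun k => [seq nat_of_bool b | b <- [:: b1; b2; b5; b12; b13; b14; b15;
         b24; b25; b123; b124; b125; b135; b145; b245; b1234; b1235; b1245;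
         bP; bP']] == [seq nth 0 row k | row <- table_rows]) (iota 0 6)
  else true else true)))))))) else true else true))))))))))
  else true)))) else true)))).
Proof. by vm_compute. Qed.

Lemma frakC_facts Delta : frakC Delta -> [/\ nonevasive Delta,
  forall s (G : graph), G \in Delta -> eperm s @: G \in Delta,
  down_closed Delta & [set: edge] \notin Delta].
Proof.
case=> P [iso mono nontriv -> ne]; split=> //.
- move=> s G; apply: iso; exists s => x y; apply/exists_inP/exists_inP.
    case=> _ /imsetP[e eG ->] /eqP; rewrite val_eperm => exy.
    exists e => //; apply/eqP/(imset_inj (@perm_inj _ s)).
    by rewrite exy imsetU1 imset_set1.
  case=> e eG /eqP exy; exists (eperm s e); first exact: imset_f.
  by rewrite val_eperm exy imsetU1 imset_set1.
apply/negP => full; case: nontriv; left; apply/setP => G; rewrite inE.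
exact: mono (subsetT G) full.
Qed.

Theorem theorem14 (Delta : {set {set edge}}) (hDelta : frakC Delta) :
  exists c : 'I_6, forall (G : graph) (row : seq nat),
    (G, row) \in table -> indicator Delta G = nth 0 row c.
Proof.
have [ne iso dc full] := frakC_facts hDelta.
pose g := graph_in Delta; pose c Ds := g (circ_rel Ds).
have circ_imp := embeddingsP iso dc circulant_embeddings_ok.
have pet_imp := embeddingsP iso dc petersen_embeddings_ok.
move/bothP/(_ (c [:: 5]))/bothP/(_ (c [:: 1; 4])): case_analysis.
move/bothP/(_ (c [:: 1; 4; 5]))/bothP/(_ (c [:: 1; 2; 3; 4])).
move/ifP_true/(_ (introT eqP (euler_matching iso dc ne full))).
move/bothP/(_ (c [:: 1; 3; 5]))/bothP/(_ (c [:: 2])).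
move/bothP/(_ (c [:: 1; 2; 3; 5]))/bothP/(_ (c [:: 2; 4])).
move/ifP_true/(_ (introT eqP (euler_cliques iso dc ne full))).
move/bothP/(_ (c [:: 1; 5]))/bothP/(_ (c [:: 1; 2])).
move/bothP/(_ (c [:: 2; 5]))/bothP/(_ (c [:: 1]))/bothP/(_ (c [:: 1; 3])).
move/bothP/(_ (c [:: 1; 2; 5]))/bothP/(_ (c [:: 1; 2; 3])).
move/bothP/(_ (c [:: 2; 4; 5]))/bothP/(_ (c [:: 1; 2; 4])).
move/bothP/(_ (c [:: 1; 2; 4; 5]))/ifP_true/(_ circ_imp).
move/ifP_true/(_ (introT eqP (euler_cyclic iso dc ne full))).
move/bothP/(_ (g petersen_rel))/bothP/(_ (g compl_petersen_rel)).
move/bothP/(_ (g five_cycle))/bothP/(_ (g five_clique)).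
move/bothP/(_ (g cycle_clique))/bothP/(_ (g (rel_union five_cycle matching))).
move/bothP/(_ (g (rel_union five_clique matching))).
move/bothP/(_ (g (rel_union cycle_clique matching)))/ifP_true/(_ pet_imp).
move/ifP_true/(_ (introT eqP (euler_pentagons iso dc ne full))).
case/hasP=> k; rewrite mem_iota => /andP[_ k6] /eqP rowE.
exists (Ordinal k6) => G row Grow.
have {}rowE : [seq indicator Delta r.1 | r <- table] =
    [seq nth 0 r.2 k | r <- table].
  rewrite (map_comp (nth 0 ^~ k) snd) -/(unzip2 table) table_rowsE.
  by rewrite -[RHS]rowE /table /= /indicator !circE compl_petersenE petersenE.
by have /eq_in_map/(_ _ Grow) := rowE.
Qed.
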